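(* Let $G$ be a connected simple Lie group with finite center, locally isomorphic to $\mathrm{SO}(n,1)$ with $n\ge 3$ or to $\mathrm{SU}(n,1)$ with $n\ge 2$, and let $\pi$ be any unitary $G$-representation. Let $\Lambda<G$ be any noncompact (i.e. not relatively compact) subgroup. Then the natural restriction map $H^1(G,\pi)\to H^1(\Lambda,\pi|_\Lambda)$ is injective.
   Context: $\mathrm{SO}(n,1)$ denotes the identity component of the subgroup of $\mathrm{SL}_{n+1}(\mathbb{R})$ preserving $x_1^2+\dots+x_n^2-x_{n+1}^2$, and $\mathrm{SU}(n,1)$ the subgroup of $\mathrm{SL}_{n+1}(\mathbb{C})$ preserving $|x_1|^2+\dots+|x_n|^2-|x_{n+1}|^2$. For a topological group $G$ and a continuous unitary representation $(\pi,\mathcal{H})$, $H^1(G,\pi)$ is the quotient of the vector space of continuous maps $b:G\to\mathcal{H}$ satisfying $b(gh)=b(g)+\pi(g)b(h)$ by the subspace of maps $b(g)=\pi(g)v-v$ with $v\in\mathcal{H}$. *)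

(* Defs.v *)
From HB Require Import structures.
From mathcomp Require Import all_boot all_order all_algebra ring_quotient.
From mathcomp Require Import sesquilinear complex.
From mathcomp Require Import all_classical all_reals all_analysis.

Set Implicit Arguments.
Unset Strict Implicit.
Unset Printing Implicit Defensive.

Import Order.TTheory GRing.Theory Num.Theory.
Import numFieldNormedType.Exports.

Local Open Scope classical_set_scope.
Local Open Scope ring_scope.

HB.mixin Record isTopologicalGroup G & Topological G & Group G := {
  mulg_continuous : continuous (fun p : G * G => (p.1 * p.2)%g) ;
  invg_continuous : continuous (fun x : G => (x^-1)%g)
}.

#[short(type="topologicalGroupType")]
HB.structure Definition TopologicalGroup :=
  {G of Topological G & Group G & isTopologicalGroup G}.

Record subgroup (G : groupType) := Subgroup {
  subgroup_set :> set G ;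
  subgroup1 : subgroup_set 1%g ;
  subgroupM : forall x y, subgroup_set x -> subgroup_set y ->
    subgroup_set (x * y)%g ;
  subgroupV : forall x, subgroup_set x -> subgroup_set (x^-1)%g
}.

Section subgroup_topologicalGroup.
Variables (G : topologicalGroupType) (L : subgroup G).

Definition subgroup_type : Type := set_type (subgroup_set L).

HB.instance Definition _ :=
  SubChoice.copy subgroup_type {x : G | x \in subgroup_set L}.

Lemma subgroup_group_closed : group_closed (fun x : G => x \in subgroup_set L).
Proof.
split=> [|x y]; rewrite ?unfold_in ?inE; first exact: subgroup1.
by move=> Lx Ly; apply: subgroupM => //; exact: subgroupV.
Qed.

HB.instance Definition _ :=
  SubChoice_isSubGroup.Build G (fun x => x \in subgroup_set L) subgroup_type
    subgroup_group_closed.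

HB.instance Definition _ :=
  Topological.copy subgroup_type (initial_topology (val : subgroup_type -> G)).

Lemma subgroup_val_continuous : continuous (val : subgroup_type -> G).
Proof. exact: initial_continuous. Qed.

Lemma subgroup_continuousP (T : topologicalType) (f : T -> subgroup_type) :
  continuous (fun x => val (f x)) -> continuous f.
Proof. exact: continuous_comp_initial. Qed.

Lemma subgroup_mulg_continuous :
  continuous (fun p : subgroup_type * subgroup_type => (p.1 * p.2)%g).
Proof.
apply: subgroup_continuousP => p.
apply: (@continuous_comp _ _ _
  (fun p : subgroup_type * subgroup_type => (val p.1, val p.2))
  (fun p : G * G => (p.1 * p.2)%g)); last exact: mulg_continuous.
apply: cvg_pair => /=; apply: continuous_comp.
- exact: cvg_fst.
- exact: subgroup_val_continuous.
- exact: cvg_snd.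
- exact: subgroup_val_continuous.
Qed.

Lemma subgroup_invg_continuous :
  continuous (fun x : subgroup_type => (x^-1)%g).
Proof.
apply: subgroup_continuousP => x.
apply: (@continuous_comp _ _ _ (val : subgroup_type -> G)
  (fun x : G => (x^-1)%g)); last exact: invg_continuous.
exact: subgroup_val_continuous.
Qed.

HB.instance Definition _ := isTopologicalGroup.Build subgroup_type
  subgroup_mulg_continuous subgroup_invg_continuous.

End subgroup_topologicalGroup.

Section smooth.
Variables (R : realType) (V W : normedModType R).

(* On an open set of a finite-dimensional space, C^k is expressed by the
   existence and continuity of all iterated directional derivatives of order
   at most k. *)
Fixpoint Ck (k : nat) (U : set V) (f : V -> W) : Prop :=
  {within U, continuous f} /\
  if k is k'.+1 then
    forall v, (forall x, U x -> derivable f x v) /\ Ck k' U ('D_v f)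
  else True.

Definition smooth_on (U : set V) (f : V -> W) := forall k, Ck k U f.

End smooth.

(* [chart_inv] is only meaningful on the open set [chart_cod c]. *)
Record chart (R : realType) (T : topologicalType) (d : nat) := Chart {
  chart_dom : set T ;
  chart_fun :> T -> 'rV[R]_d ;
  chart_inv : 'rV[R]_d -> T ;
  chart_dom_open : open chart_dom ;
  chart_cod_open : open (chart_fun @` chart_dom) ;
  chart_continuous : {within chart_dom, continuous chart_fun} ;
  chart_inv_continuous :
    {within chart_fun @` chart_dom, continuous chart_inv} ;
  chartK : forall x, chart_dom x -> chart_inv (chart_fun x) = x
}.

Definition chart_cod (R : realType) (T : topologicalType) (d : nat)
  (c : chart R T d) : set 'rV[R]_d := c @` chart_dom c.

Definition smooth_atlas (R : realType) (T : topologicalType) (d : nat)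
    (A : set (chart R T d)) : Prop :=
  (forall x, exists2 c, A c & chart_dom c x) /\
  (forall a b, A a -> A b ->
     smooth_on [set p | chart_cod a p /\ chart_dom b (chart_inv a p)]
               (fun p => b (chart_inv a p))).

Definition smooth_group (R : realType) (G : topologicalGroupType) (d : nat)
    (A : set (chart R G d)) : Prop :=
  (forall a b c, A a -> A b -> A c ->
     smooth_on [set p : 'rV[R]_d * 'rV[R]_d |
                 [/\ chart_cod a p.1, chart_cod b p.2 &
                     chart_dom c (chart_inv a p.1 * chart_inv b p.2)%g]]
               (fun p => c (chart_inv a p.1 * chart_inv b p.2)%g)) /\
  (forall a b, A a -> A b ->
     smooth_on [set p | chart_cod a p /\ chart_dom b ((chart_inv a p)^-1)%g]
               (fun p => b ((chart_inv a p)^-1)%g)).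

Definition lie_group (R : realType) (G : topologicalGroupType) : Prop :=
  [/\ hausdorff_space G, @second_countable G &
      exists (d : nat) (A : set (chart R G d)),
        smooth_atlas A /\ smooth_group A].

Definition group_center (G : groupType) : set G :=
  [set z | forall g, (z * g = g * z)%g].
Arguments group_center : clear implicits.

Definition normal_subgroup (G : groupType) (N : subgroup G) : Prop :=
  forall g x, subgroup_set N x -> subgroup_set N (x ^ g)%g.

Definition connected_simple_lie_group (R : realType)
    (G : topologicalGroupType) : Prop :=
  [/\ lie_group R G, connected [set: G], group_center G <> [set: G] &
      forall N : subgroup G, normal_subgroup N -> closed N -> connected N ->
        N = [set 1%g] :> set G \/ N = [set: G] :> set G].

(* [L] stands for a group of invertible matrices, with the topology induced by
   that of the space of all matrices; the requested local isomorphism goes from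
   the open neighbourhood [U] of 1 in [G] to the relatively open neighbourhood
   [L `&` W] of 1 in [L]. *)
Definition locally_isomorphic (G : topologicalGroupType) (K : numFieldType)
    (m : nat) (L : set 'M[K]_m) : Prop :=
  exists (U : set G) (W : set 'M[K]_m) (f : G -> 'M[K]_m) (g : 'M[K]_m -> G),
    [/\ open_nbhs 1%g U, open_nbhs (1%:M : 'M[K]_m) W,
        [/\ {homo f : x / U x >-> (L `&` W) x},
            {homo g : y / (L `&` W) y >-> U y},
            forall x, U x -> g (f x) = x & forall y, (L `&` W) y -> f (g y) = y],
        {within U, continuous f} /\ {within L `&` W, continuous g} &
        forall x y, U x -> U y ->
          (U (x * y)%g <-> (L `&` W) (f x *m f y)) /\
          (U (x * y)%g -> f (x * y)%g = f x *m f y)].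

(* [lift ord_max i] is the index i, seen in 'I_n.+1; the n+1-st coordinate is
   the one of index [ord_max]. *)
Definition lorentz_form (R : realType) (n : nat) (x : 'cV[R]_n.+1) : R :=
  \sum_(i < n) x (lift ord_max i) 0 ^+ 2 - x ord_max 0 ^+ 2.

Definition lorentz_hermitian_form (R : realType) (n : nat)
    (x : 'cV[R[i]]_n.+1) : R[i] :=
  \sum_(i < n) `|x (lift ord_max i) 0| ^+ 2 - `|x ord_max 0| ^+ 2.

Definition SO_n1 (R : realType) (n : nat) : set 'M[R]_n.+1 :=
  connected_component
    [set A | \det A = 1 /\ forall x, lorentz_form (A *m x) = lorentz_form x]
    1%:M.
Arguments SO_n1 : clear implicits.

Definition SU_n1 (R : realType) (n : nat) : set 'M[R[i]]_n.+1 :=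
  [set A | \det A = 1 /\
     forall x, lorentz_hermitian_form (A *m x) = lorentz_hermitian_form x].
Arguments SU_n1 : clear implicits.

Record hilbertType (R : realType) := Hilbert {
  hilbert_sort :> completeNormedModType R[i] ;
  inner : {dot hilbert_sort for Num.conj_op} ;
  inner_norm : forall v, inner v v = `|v| ^+ 2
}.

Record unitaryRep (R : realType) (G : topologicalGroupType)
    (H : hilbertType R) := UnitaryRep {
  rep_fun :> G -> H -> H ;
  rep_linear : forall g, linear (rep_fun g) ;
  rep_unitary : forall g u v,
    inner H (rep_fun g u) (rep_fun g v) = inner H u v ;
  rep1 : forall v, rep_fun 1%g v = v ;
  repM : forall g h v, rep_fun (g * h)%g v = rep_fun g (rep_fun h v) ;
  rep_continuous : forall v, continuous (fun g => rep_fun g v)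
}.

Section restriction.
Variables (R : realType) (G : topologicalGroupType) (H : hilbertType R).
Variables (pi : unitaryRep G H) (L : subgroup G).

Lemma res_rep_continuous v :
  continuous (fun g : subgroup_type L => pi (val g) v).
Proof.
move=> x.
apply: (@continuous_comp (subgroup_type L) G H val (fun g => pi g v)).
  exact: subgroup_val_continuous.
exact: rep_continuous.
Qed.

Definition res_rep : unitaryRep (subgroup_type L) H :=
  @UnitaryRep R (subgroup_type L) H (fun g => pi (val g))
    (fun g => rep_linear pi (val g)) (fun g => rep_unitary pi (val g))
    (rep1 pi) (fun g h => repM pi (val g) (val h)) res_rep_continuous.

End restriction.

Section cohomology.
Variables (R : realType) (G : topologicalGroupType) (H : hilbertType R).
Variable pi : unitaryRep G H.

Definition cocycle : set (G -> H) :=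
  [set b | continuous b /\ forall g h, b (g * h)%g = b g + pi g (b h)].

Definition coboundary : set (G -> H) :=
  [set b | exists v, forall g, b g = pi g v - v].

Definition Z1 : Type := {b : G -> H | b \in cocycle}.

HB.instance Definition _ := SubChoice.copy Z1 {b : G -> H | b \in cocycle}.

Lemma rep_fun0 g : pi g 0 = 0.
Proof.
by have := rep_linear pi g (-1) 0 0; rewrite scaleN1r addNr scaleN1r addNr.
Qed.

Lemma cocycle_submod_closed :
  submod_closed (fun b : G -> H => b \in cocycle).
Proof.
split=> [|a b c]; rewrite !unfold_in !inE.
  split=> [|g h]; first exact: cst_continuous.
  by rewrite rep_fun0 addr0.
move=> [cb Hb] [cc Hc]; split=> [x|g h].
  apply: continuousD; last exact: cc.
  by apply: continuousZr; exact: cb.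
rewrite -[LHS]/(a *: b (g * h)%g + c (g * h)%g).
rewrite -[RHS]/(a *: b g + c g + pi g (a *: b h + c h)).
by rewrite Hb Hc rep_linear scalerDr addrACA.
Qed.

HB.instance Definition _ := GRing.SubChoice_isSubLmodule.Build R[i] (G -> H)
  (fun b => b \in cocycle) Z1 cocycle_submod_closed.

Definition B1 : {pred Z1} := fun b => val b \in coboundary.

Lemma B1_submod_closed : submod_closed B1.
Proof.
split=> [|a b c]; rewrite !unfold_in !inE.
  by exists 0 => g; rewrite rep_fun0 subrr.
move=> [v Hv] [w Hw]; exists (a *: v + w) => g.
by rewrite rep_linear opprD addrACA -scalerBr -Hv -Hw.
Qed.

HB.instance Definition _ :=
  GRing.isSubmodClosed.Build R[i] Z1 B1 B1_submod_closed.

Definition H1 : Type := Quotient.quot B1.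

HB.instance Definition _ := EqQuotient.on H1.
HB.instance Definition _ := GRing.Zmodule.on H1.

Definition H1_class (b : Z1) : H1 := \pi_(Quotient.quot B1)%qT b.

Lemma H1_class_eq (b c : Z1) : (H1_class b == H1_class c) = (b - c \in B1).
Proof. by rewrite Quotient.idealrBE. Qed.

Lemma H1_classK x : H1_class (repr x) = x.
Proof. exact: reprK. Qed.

Lemma H1_classD : {morph H1_class : b c / b + c}.
Proof. by move=> b c; exact: raddfD. Qed.

Definition H1_scale (a : R[i]) (x : H1) : H1 := H1_class (a *: repr x).

Lemma H1_class_scale a b : H1_class (a *: b) = H1_scale a (H1_class b).
Proof.
apply/eqP; rewrite H1_class_eq -scalerBr; apply: rpredZ.
by rewrite -H1_class_eq H1_classK.
Qed.

Lemma H1_scaleA a b x : H1_scale a (H1_scale b x) = H1_scale (a * b) x.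
Proof. by rewrite -(H1_classK x) -!H1_class_scale scalerA. Qed.

Lemma H1_scale1 : left_id 1 H1_scale.
Proof. by move=> x; rewrite -(H1_classK x) -H1_class_scale scale1r. Qed.

Lemma H1_scaleDr : right_distributive H1_scale +%R.
Proof.
move=> a x y; rewrite -(H1_classK x) -(H1_classK y).
by rewrite -H1_classD -!H1_class_scale -H1_classD scalerDr.
Qed.

Lemma H1_scaleDl x : {morph H1_scale^~ x : a b / a + b}.
Proof.
move=> a b; rewrite -(H1_classK x).
by rewrite -!H1_class_scale -H1_classD scalerDl.
Qed.

HB.instance Definition _ := GRing.Zmodule_isLmodule.Build R[i] H1
  H1_scaleA H1_scale1 H1_scaleDr H1_scaleDl.

Lemma H1_class_linear : linear H1_class.
Proof. by move=> a b c; rewrite H1_classD H1_class_scale. Qed.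

End cohomology.
Arguments B1 {R G H} pi.

Section cohomology_restriction.
Variables (R : realType) (G : topologicalGroupType) (H : hilbertType R).
Variables (pi : unitaryRep G H) (L : subgroup G).

Lemma Z1_res_subproof (b : Z1 pi) :
  (fun g : subgroup_type L => val b (val g)) \in cocycle (res_rep pi L).
Proof.
rewrite inE; have := valP b; rewrite inE => -[cb Hb].
split=> [x|g h]; last exact: Hb.
apply: (@continuous_comp (subgroup_type L) G H val (val b)); last exact: cb.
exact: subgroup_val_continuous.
Qed.

Definition Z1_res (b : Z1 pi) : Z1 (res_rep pi L) :=
  exist _ (fun g => val b (val g)) (Z1_res_subproof b).

(* The class of [b] is sent to the class of its restriction, whatever the
   representative [b]: see [H1_resE]. *)
Definition H1_res (x : H1 pi) : H1 (res_rep pi L) :=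
  H1_class (Z1_res (repr x)).

Lemma H1_resE b : H1_res (H1_class b) = H1_class (Z1_res b).
Proof.
apply/eqP; rewrite H1_class_eq.
have : repr (H1_class b) - b \in B1 pi by rewrite -H1_class_eq H1_classK.
rewrite !unfold_in !inE => -[v Hv]; exists v => g; exact: Hv.
Qed.

Lemma H1_res_linear : linear H1_res.
Proof.
move=> a x y; rewrite -(H1_classK x) -(H1_classK y).
rewrite -H1_class_linear !H1_resE -H1_class_linear.
by congr H1_class; exact: val_inj.
Qed.

HB.instance Definition _ :=
  GRing.isLinear.Build R[i] (H1 pi) (H1 (res_rep pi L)) _ H1_res H1_res_linear.

End cohomology_restriction.
Arguments H1_res {R G H} pi L x.

(* Main.v *)
Require Import Defs.
From mathcomp Require Import all_boot all_order all_algebra perm.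
From mathcomp Require Import sesquilinear complex ring lra.
From mathcomp Require Import all_classical all_reals all_analysis.

(* A cocycle [b] of [G] defines a length function [g |-> |b g|], which is
   bounded on [Lambda] when the restriction of [b] is a coboundary.  Bounded
   cocycles are coboundaries (take the circumcenter of the orbit of 0 under the
   affine action), so it suffices to show that [|b|] is bounded on [G].

   Conjugation near 1 identifies [G], up to centers (that of [G] is finite),
   with an open subgroup of [L = SO(n,1)] or [SU(n,1)]; under this
   correspondence relatively compact sets are the sets of bounded matrices.
   Let [K] be the compact stabiliser of a point [o] of hyperbolic space.  If [D]
   moves [o] by a distance [r], the rotations in [D K D^-1] move [o] to every
   distance up to [2 r], hence [K D K D^-1 K] contains every element moving [o]
   by at most [2 r].  Elements of [Lambda] have bounded length and move [o]
   arbitrarily far, so all elements of [G] have bounded length. *)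

Set Implicit Arguments.
Unset Strict Implicit.
Unset Printing Implicit Defensive.

Import Order.TTheory GRing.Theory Num.Theory.
Import numFieldNormedType.Exports.
Local Open Scope classical_set_scope.
Local Open Scope ring_scope.

(** * Reflections and the Lorentzian form *)

Section adjoint.
Variables (K : comNzRingType) (cj : {rmorphism K -> K}).
Hypothesis cjK : involutive cj.

(** Conjugate transpose. Keeping [cj] abstract treats the real case, where it is the identity,
    together with the complex case, where it is conjugation. *)
Definition adjmx m p (A : 'M[K]_(m, p)) : 'M[K]_(p, m) := (map_mx cj A)^T.

Lemma adjmxM m p q (A : 'M[K]_(m, p)) (B : 'M[K]_(p, q)) :
  adjmx (A *m B) = adjmx B *m adjmx A.
Proof. by rewrite /adjmx map_mxM trmx_mul. Qed.

Lemma adjmxK m p (A : 'M[K]_(m, p)) : adjmx (adjmx A) = A.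
Proof. by apply/matrixP => i j; rewrite !mxE cjK. Qed.

Lemma adjmxB m p (A B : 'M[K]_(m, p)) : adjmx (A - B) = adjmx A - adjmx B.
Proof. by apply/matrixP => i j; rewrite !mxE rmorphB. Qed.

Lemma adjmxZ m p a (A : 'M[K]_(m, p)) : adjmx (a *: A) = cj a *: adjmx A.
Proof. by apply/matrixP => i j; rewrite !mxE rmorphM. Qed.

Lemma adjmx1 m : adjmx (1%:M : 'M[K]_m) = 1%:M.
Proof. by rewrite /adjmx map_mx1 trmx1. Qed.

Definition dot m (u v : 'cV[K]_m) : K := (adjmx u *m v) 0 0.

Lemma dotE m (u v : 'cV[K]_m) : dot u v = \sum_i cj (u i 0) * v i 0.
Proof. by rewrite /dot mxE; apply: eq_bigr => i _; rewrite !mxE. Qed.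

Lemma adjmx_mul_dot m (u v : 'cV[K]_m) : adjmx u *m v = (dot u v)%:M.
Proof. by rewrite [LHS]mx11_scalar. Qed.

Lemma dotC m (u v : 'cV[K]_m) : dot v u = cj (dot u v).
Proof.
rewrite !dotE rmorph_sum; apply: eq_bigr => i _.
by rewrite rmorphM cjK mulrC.
Qed.

Lemma dotDr m (u v w : 'cV[K]_m) : dot u (v + w) = dot u v + dot u w.
Proof. by rewrite /dot mulmxDr mxE. Qed.

Lemma dotBr m (u v w : 'cV[K]_m) : dot u (v - w) = dot u v - dot u w.
Proof. by rewrite /dot mulmxBr !mxE. Qed.

Lemma dotDl m (u v w : 'cV[K]_m) : dot (v + w) u = dot v u + dot w u.
Proof. by rewrite dotC dotDr rmorphD -!dotC. Qed.

Lemma dotBl m (u v w : 'cV[K]_m) : dot (v - w) u = dot v u - dot w u.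
Proof. by rewrite dotC dotBr rmorphB -!dotC. Qed.

Lemma dotZr m a (u v : 'cV[K]_m) : dot u (a *: v) = a * dot u v.
Proof. by rewrite /dot -scalemxAr mxE. Qed.

Lemma dotZl m a (u v : 'cV[K]_m) : dot (a *: u) v = cj a * dot u v.
Proof. by rewrite dotC dotZr rmorphM -dotC. Qed.

Lemma dot_mulmx m p (A : 'M[K]_(m, p)) u v :
  dot (A *m u) v = dot u (adjmx A *m v).
Proof. by rewrite /dot adjmxM mulmxA. Qed.

Lemma dot_deltal m i (v : 'cV[K]_m) : dot (delta_mx i 0) v = v i 0.
Proof.
rewrite dotE (bigD1 i) //= big1 => [|j ji].
  by rewrite mxE !eqxx rmorph1 mul1r addr0.
by rewrite mxE (negPf ji) rmorph0 mul0r.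
Qed.

End adjoint.

(** Both Schur complements of the block matrix [M] compute its determinant. *)
Lemma det_1_sub_mul (K : comNzRingType) m (u : 'cV[K]_m) (v : 'rV[K]_m) :
  \det (1%:M - u *m v) = 1 - (v *m u) 0 0.
Proof.
pose M := block_mx (1%:M : 'M[K]_1) v u (1%:M : 'M[K]_m).
have E1 : M = block_mx (1%:M : 'M[K]_1) 0 u 1%:M *m
    block_mx 1%:M v 0 (1%:M - u *m v).
  by rewrite mulmx_block !mul1mx !mul0mx !mulmx1 ?mulmx0 ?addr0 addrC subrK.
have E2 : M = block_mx 1%:M v 0 1%:M *m block_mx (1%:M - v *m u) 0 u 1%:M.
  rewrite mulmx_block ?mul1mx ?mul0mx ?mulmx1 ?add0r.
  by rewrite subrK.
have := congr1 determinant E1; rewrite E2 !det_mulmx det_ublock det_lblock.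
rewrite det_ublock det_lblock !det1 !mul1r !mulr1 => <-.
by rewrite det_mx11 !mxE eqxx.
Qed.

Section reflection.
Variables (K : numFieldType) (cj : {rmorphism K -> K}).
Hypothesis cjK : involutive cj.
Hypothesis mul_cj : forall x, x * cj x = `|x| ^+ 2.

Local Notation adjmx := (adjmx cj).
Local Notation dot := (dot cj).

Lemma cj_ge0 x : 0 <= x -> cj x = x.
Proof.
rewrite le0r => /predU1P[->|x0]; first by rewrite rmorph0.
by apply: (mulfI (lt0r_neq0 x0)); rewrite mul_cj gtr0_norm.
Qed.

Lemma norm_cj x : `|cj x| = `|x|.
Proof.
by apply/eqP; rewrite -(@eqrXn2 _ 2) // -!mul_cj cjK mulrC.
Qed.

Lemma dot_norm m (u : 'cV[K]_m) : dot u u = \sum_i `|u i 0| ^+ 2.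
Proof. by rewrite dotE; apply: eq_bigr => i _; rewrite mulrC mul_cj. Qed.

Lemma dot_ge0 m (u : 'cV[K]_m) : 0 <= dot u u.
Proof. by rewrite dot_norm sumr_ge0 // => i _; rewrite exprn_ge0. Qed.

Lemma dot_eq0 m (u : 'cV[K]_m) : (dot u u == 0) = (u == 0).
Proof.
apply/eqP/eqP => [|->]; last by rewrite dotE big1 // => i _; rewrite mxE mulr0.
rewrite dot_norm => /psumr_eq0P; move=> u0.
apply/matrixP => i j; rewrite ord1 mxE; apply/eqP; rewrite -normr_eq0.
suff : `|u i 0| ^+ 2 == 0 by rewrite expf_eq0.
by rewrite u0 // => k _; rewrite exprn_ge0.
Qed.

(** The unitary reflection in the hyperplane orthogonal to [v]; since the inverse of 0 is 0, it is
    the identity when [v = 0]. *)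
Definition refl m (v : 'cV[K]_m) : 'M[K]_m :=
  1%:M - (2 / dot v v) *: (v *m adjmx v).

Lemma refl_mul m (v x : 'cV[K]_m) :
  refl v *m x = x - (2 / dot v v * dot v x) *: v.
Proof.
rewrite mulmxBl mul1mx -scalemxAl -mulmxA adjmx_mul_dot.
by rewrite mul_mx_scalar scalerA.
Qed.

Lemma refl_scale m c (v : 'cV[K]_m) : c != 0 -> refl (c *: v) = refl v.
Proof.
move=> c0; rewrite /refl dotZl // dotZr adjmxZ -scalemxAr -scalemxAl !scalerA.
have cc0 : cj c != 0 by rewrite fmorph_eq0.
congr (_ - _ *: _); have [->|v0] := eqVneq (dot v v) 0.
  by rewrite !mulr0 !invr0 !mulr0 !mul0r.
by field; rewrite v0 c0 cc0.
Qed.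

Lemma refl_adj m (v : 'cV[K]_m) : adjmx (refl v) = refl v.
Proof.
rewrite adjmxB adjmx1 adjmxZ adjmxM adjmxK // cj_ge0 //.
by rewrite divr_ge0 ?dot_ge0.
Qed.

Lemma refl_sqr m (v : 'cV[K]_m) : refl v *m refl v = 1%:M.
Proof.
have [v0|v0] := eqVneq (dot v v) 0.
  by rewrite /refl v0 invr0 mulr0 scale0r subr0 mulmx1.
rewrite {2}/refl mulmxBr mulmx1 -scalemxAr mulmxA refl_mul -mulrA mulVf //.
rewrite mulr1 -[X in X - _ *: v]scale1r -scalerBl -scalemxAl scalerA.
rewrite /refl -addrA -opprD -scalerDl [X in X *: _](_ : _ = 0); last by ring.
by rewrite scale0r subr0.
Qed.

Lemma det_refl m (v : 'cV[K]_m) : v != 0 -> \det (refl v) = -1.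
Proof.
rewrite -dot_eq0 => v0.
rewrite /refl scalemxAl det_1_sub_mul -scalemxAr mxE -/(dot v v) -mulrA.
by rewrite mulVf // mulr1; ring.
Qed.

(** The hypotheses give [dot (x - y) (x - y) = 2 * dot (x - y) x], so the coefficient in [refl_mul]
    is 1. Over the complex numbers, [dot x y = dot y x] means that this product is real. *)
Lemma refl_swap m (x y : 'cV[K]_m) : dot x x = dot y y -> dot x y = dot y x ->
  refl (x - y) *m x = y.
Proof.
move=> xxyy xy; have [->|nxy] := eqVneq x y.
  by rewrite refl_mul subrr scaler0 subr0.
have d0 : dot (x - y) (x - y) != 0 by rewrite dot_eq0 subr_eq0.
rewrite refl_mul (_ : _ * _ = 1) ?scale1r ?subKr //.
apply: (mulfI d0); rewrite mulr1 mulrA mulrCA divff // mulr1.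
by rewrite !dotBl // !dotBr xy xxyy; ring.
Qed.

Lemma refl_orth m (v x : 'cV[K]_m) : dot v x = 0 -> refl v *m x = x.
Proof. by move=> vx; rewrite refl_mul vx mulr0 scale0r subr0. Qed.

Lemma refl_comm m (v w : 'cV[K]_m) : dot v w = 0 ->
  refl v *m refl w = refl w *m refl v.
Proof.
move=> vw; transitivity (refl v - (2 / dot w w) *: (w *m adjmx w)).
  by rewrite {2}/refl mulmxBr mulmx1 -scalemxAr mulmxA refl_orth.
rewrite {2}/refl mulmxBl mul1mx -scalemxAl -mulmxA; congr (_ - _ *: (_ *m _)).
by rewrite -[RHS](adjmxK cjK) adjmxM (adjmxK cjK) refl_adj refl_orth.
Qed.

End reflection.

(** * Matrices preserving the Lorentzian form *)

Section lorentz.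
Variables (K : numFieldType) (cj : {rmorphism K -> K}) (n : nat).
Hypothesis cjK : involutive cj.
Hypothesis mul_cj : forall x, x * cj x = `|x| ^+ 2.

Local Notation adjmx := (adjmx cj).
Local Notation dot := (dot cj).
Local Notation refl := (refl cj).
Local Notation e := (delta_mx ord_max 0 : 'cV[K]_n.+1).

(* diag(1, ..., 1, -1), the matrix of the Lorentzian form *)
Definition lorentz_mx : 'M[K]_n.+1 := refl e.
Local Notation J := lorentz_mx.

Definition unitary_lorentz (A : 'M[K]_n.+1) := adjmx A *m J *m A = J.

Lemma dot_ee : dot e e = 1.
Proof. by rewrite dot_deltal mxE !eqxx. Qed.

Lemma lorentz_mx_mul (x : 'cV[K]_n.+1) : J *m x = x - (2 * x ord_max 0) *: e.
Proof. by rewrite refl_mul dot_ee divr1 dot_deltal. Qed.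

Lemma lorentz_mx_sqr : J *m J = 1%:M. Proof. exact: refl_sqr. Qed.

Lemma lorentz_mx_adj : adjmx J = J. Proof. exact: refl_adj. Qed.

Definition hdot (x y : 'cV[K]_n.+1) := dot x (J *m y).

Lemma hdotE x y : hdot x y = dot x y - 2 * cj (x ord_max 0) * y ord_max 0.
Proof.
rewrite /hdot lorentz_mx_mul dotBr dotZr (dotC cjK e) dot_deltal.
by rewrite mulrAC.
Qed.

Lemma hdot_el x : hdot e x = - x ord_max 0.
Proof.
rewrite hdotE dot_deltal mxE !eqxx rmorph1; ring.
Qed.

Lemma hdot_unitary A x y : unitary_lorentz A ->
  hdot (A *m x) (A *m y) = hdot x y.
Proof.
by move=> UA; rewrite /hdot dot_mulmx !mulmxA UA.
Qed.


Lemma unitary_lorentzV A : unitary_lorentz A ->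
  A \in unitmx /\ invmx A = J *m adjmx A *m J.
Proof.
move=> UA; have E : J *m adjmx A *m J *m A = 1%:M.
  by rewrite -!mulmxA [adjmx A *m _]mulmxA UA lorentz_mx_sqr.
have [_ uA] := mulmx1_unit E; split => //.
by rewrite -[RHS](mulmxK uA) E mul1mx.
Qed.

(** This rearranges [A *m invmx A = 1] with [invmx A = J *m adjmx A *m J]; it turns identities about
    columns into identities about rows. *)
Lemma unitary_lorentz_adj A : unitary_lorentz A -> unitary_lorentz (adjmx A).
Proof.
move=> UA; have [uA EA] := unitary_lorentzV UA.
rewrite /unitary_lorentz (adjmxK cjK) -[RHS]mul1mx -(mulmxV uA) EA.
by rewrite !mulmxA -!mulmxA lorentz_mx_sqr mulmx1.
Qed.

Lemma unitary_lorentz_mul A B : unitary_lorentz A -> unitary_lorentz B ->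
  unitary_lorentz (A *m B).
Proof.
rewrite /unitary_lorentz => UA UB.
rewrite adjmxM -!mulmxA [adjmx A *m _]mulmxA [_ *m (A *m B)]mulmxA UA.
by rewrite !mulmxA.
Qed.

Lemma unitary_lorentz_inv A : unitary_lorentz A -> unitary_lorentz (invmx A).
Proof.
move=> UA; have [_ ->] := unitary_lorentzV UA.
have UJ : unitary_lorentz J.
  by rewrite /unitary_lorentz lorentz_mx_adj lorentz_mx_sqr mul1mx.
by do 2?[apply: unitary_lorentz_mul => //]; exact: unitary_lorentz_adj.
Qed.

Lemma unitary_lorentz_refl (v : 'cV[K]_n.+1) :
  v ord_max 0 = 0 -> unitary_lorentz (refl v).
Proof.
move=> v0; rewrite /unitary_lorentz refl_adj // refl_comm //.
  by rewrite -mulmxA refl_sqr // mulmx1.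
by rewrite (dotC cjK e) dot_deltal v0 rmorph0.
Qed.

Lemma unitary_lorentz_col A j : unitary_lorentz A ->
  \sum_i `|A i j| ^+ 2 - 2 * `|A ord_max j| ^+ 2 = (-1) ^+ (j == ord_max).
Proof.
move=> UA; have := hdot_unitary (delta_mx j 0) (delta_mx j 0) UA.
rewrite !hdotE dot_norm // dot_deltal -colE !mxE !eqxx eq_sym andbT.
rewrite -!mulrA [cj _ * _]mulrC mul_cj.
have -> : \sum_i `|col j A i 0| ^+ 2 = \sum_i `|A i j| ^+ 2.
  by apply: eq_bigr => i _; rewrite mxE.
move=> ->; case: eqP => _; rewrite ?rmorph1 ?rmorph0 ?expr0 ?expr1; ring.
Qed.

(** The corner entry controls the whole matrix, so sets of matrices displacing [e] by a bounded
    amount are bounded. The column identity handles the last column, its adjoint form the last row,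
    and the row identity the other entries. *)
Lemma le_unitary_lorentz A i j : unitary_lorentz A ->
  `|A i j| <= `|A ord_max ord_max|.
Proof.
have col_le B k : unitary_lorentz B -> k != ord_max ->
    `|B k ord_max| ^+ 2 <= `|B ord_max ord_max| ^+ 2 - 1.
  move=> UB kn; have := unitary_lorentz_col ord_max UB.
  rewrite eqxx expr1 (bigD1 ord_max) //= (bigD1 k) //=.
  set S := \sum_(_ | _) _ => E.
  have S0 : 0 <= S by apply: sumr_ge0 => ? _; rewrite exprn_ge0.
  rewrite (_ : _ - 1 = `|B k ord_max| ^+ 2 + S) ?lerDl //.
  by apply: (@addIr _ (-1)); rewrite -{2}E; ring.
move=> UA; rewrite -(@ler_pXn2r _ 2) ?nnegrE //.
have [->|jn] := eqVneq j ord_max.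
  have [->//|kn] := eqVneq i ord_max.
  by apply: le_trans (col_le _ _ UA kn) _; rewrite gerBl.
have UA' := unitary_lorentz_adj UA.
have [->|kn] := eqVneq i ord_max.
  have := col_le _ _ UA' jn; rewrite !mxE !norm_cj // => /le_trans; apply.
  by rewrite gerBl.
(* Row [i] bounds the squared modulus of [A i j] by 1 plus that of [A i ord_max]; the [- 1] in
   [col_le] absorbs the extra 1. *)
have := unitary_lorentz_col i UA'; rewrite (negPf kn) expr0.
rewrite (bigD1 ord_max) //= (bigD1 j) //= !mxE !norm_cj //.
set S := \sum_(_ | _) _ => E.
have S0 : 0 <= S by apply: sumr_ge0 => ? _; rewrite exprn_ge0.
have := col_le _ _ UA kn; rewrite lerBrDl; apply: le_trans.
by rewrite -E -subr_ge0 (_ : _ - _ = S) //; ring.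
Qed.

Lemma unitary_lorentz_ge1 A : unitary_lorentz A -> 1 <= `|A ord_max ord_max|.
Proof.
move=> UA; rewrite -(@ler_pXn2r _ 2) ?nnegrE // expr1n.
have := unitary_lorentz_col ord_max UA.
rewrite eqxx expr1 (bigD1 ord_max) //=; set S := \sum_(_ | _) _ => E.
have S0 : 0 <= S by apply: sumr_ge0 => ? _; rewrite exprn_ge0.
rewrite -subr_ge0 (_ : _ - 1 = S) //.
by apply: (@addIr _ (-1)); rewrite -{2}E; ring.
Qed.

End lorentz.

(** * Transitivity of the stabiliser of a point, and composition of rotations *)

Section transitivity.
Variables (K : numFieldType) (cj : {rmorphism K -> K}) (n : nat).
Hypothesis cjK : involutive cj.
Hypothesis mul_cj : forall x, x * cj x = `|x| ^+ 2.
Hypothesis sqrtK : forall x : K, 0 <= x -> exists2 y : K, 0 <= y & y ^+ 2 = x.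
Hypothesis n2 : (2 <= n)%N.

Local Notation adjmx := (adjmx cj).
Local Notation dot := (dot cj).
Local Notation refl := (refl cj).
Local Notation e := (delta_mx ord_max 0 : 'cV[K]_n.+1).
Local Notation J := (lorentz_mx cj n).
Local Notation hdot := (@hdot K cj n).
Local Notation unitary_lorentz := (@unitary_lorentz K cj n).

Variable P : 'M[K]_n.+1 -> Prop.
Hypothesis P1 : P 1%:M.
Hypothesis PM : forall A B, P A -> P B -> P (A *m B).
Hypothesis PU : forall A, P A -> unitary_lorentz A.
Hypothesis P_refl : forall v w : 'cV[K]_n.+1, v != 0 -> w != 0 ->
  v ord_max 0 = 0 -> w ord_max 0 = 0 -> P (refl v *m refl w).

(** Since [2 <= n], there are two coordinates besides the last one, and one linear condition on
    their plane has a nonzero solution. *)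
Lemma orth_exists (x : 'cV[K]_n.+1) : exists z : 'cV[K]_n.+1,
  [/\ z != 0, z ord_max 0 = 0 & dot z x = 0].
Proof.
have n0 : (0 < n.+1)%N by []. have n1 : (1 < n.+1)%N by rewrite ltnW.
pose i0 := Ordinal n0; pose i1 := Ordinal n1.
have i01 : i0 != i1 by [].
have i0m : (ord_max : 'I_n.+1) == i0 = false.
  by apply/eqP => /(congr1 val) /= E; move: n2; rewrite E.
have i1m : (ord_max : 'I_n.+1) == i1 = false.
  by apply/eqP => /(congr1 val) /= E; move: n2; rewrite E.
have [x0|x0] := eqVneq (x i0 0) 0.
  exists (delta_mx i0 0); split; last by rewrite dot_deltal.
    by apply/eqP => /matrixP /(_ i0 0)/eqP; rewrite !mxE !eqxx oner_eq0.
  by rewrite mxE i0m.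
exists (cj (x i1 0) *: delta_mx i0 0 - cj (x i0 0) *: delta_mx i1 0); split.
- apply/eqP => /matrixP /(_ i1 0)/eqP.
  rewrite !mxE !eqxx [i1 == _]eq_sym (negPf i01) /= mulr0 mulr1 sub0r oppr_eq0.
  by rewrite fmorph_eq0 (negPf x0).
- by rewrite !mxE i0m i1m /= !mulr0 subr0.
- rewrite dotBl // !(dotZl cjK) !dot_deltal !cjK; ring.
Qed.

(** A vector from [orth_exists] is rescaled by [r] to get the length of [x], and by a scalar [m] of
    modulus 1 to make its product with [y] real, as [refl_swap] requires. *)
Lemma orth_normalized (x y : 'cV[K]_n.+1) : exists z : 'cV[K]_n.+1,
  [/\ z ord_max 0 = 0, dot z x = 0, dot z z = dot x x & dot z y = dot y z].
Proof.
have [z [z0 zm zx]] := orth_exists x.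
have zz : 0 < dot z z by rewrite lt0r dot_eq0 // z0 dot_ge0.
have [r r0 rE] : exists2 r : K, 0 <= r & r ^+ 2 = dot x x / dot z z.
  by apply: sqrtK; rewrite divr_ge0 ?dot_ge0.
have [m m1 mE] : exists2 m : K, m * cj m = 1 & 0 <= cj m * dot z y.
  have [->|d0] := eqVneq (dot z y) 0.
    by exists 1; rewrite ?rmorph1 ?mulr1 ?mulr0.
  exists (dot z y / `|dot z y|).
    by rewrite mul_cj normf_div normr_id divff ?expr1n ?normr_eq0.
  rewrite rmorphM /= fmorphV (cj_ge0 mul_cj (normr_ge0 _)) mulrAC.
  by rewrite [cj _ * _]mulrC mul_cj divr_ge0 ?exprn_ge0.
exists ((r * m) *: z); split.
- by rewrite mxE zm mulr0.
- by rewrite dotZl // zx mulr0.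
- rewrite dotZl // dotZr rmorphM /= (cj_ge0 mul_cj r0).
  rewrite [LHS](_ : _ = r ^+ 2 * (m * cj m) * dot z z); last by ring.
  by rewrite m1 mulr1 rE divfK // lt0r_neq0.
- rewrite [RHS](dotC cjK) (cj_ge0 mul_cj) // dotZl // rmorphM /= -mulrA.
  by rewrite (cj_ge0 mul_cj r0) mulr_ge0.
Qed.

(** The reflection in [x - y] carries [x] to [y]. It is preceded by a reflection fixing [x], because
    [P] is only known to contain products of two reflections; both fix [e], their vectors being
    horizontal. *)
Lemma horizontal_move (x y : 'cV[K]_n.+1) :
    x ord_max 0 = 0 -> y ord_max 0 = 0 ->
    dot x x = dot y y -> dot x y = dot y x ->
  exists k, [/\ P k, k *m e = e & k *m x = y].
Proof.
move=> xm ym xxyy xy; have [<-|nxy] := eqVneq x y.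
  by exists 1%:M; rewrite !mul1mx.
have [z [z0 zm zx]] := orth_exists x.
have xye : (x - y) ord_max 0 = 0 by rewrite !mxE xm ym subr0.
exists (refl (x - y) *m refl z); split.
- by apply: P_refl => //; rewrite subr_eq0.
- by rewrite -mulmxA !refl_orth // dotC // dot_deltal ?zm ?xye rmorph0.
- by rewrite -mulmxA [refl z *m x]refl_orth // refl_swap.
Qed.

(** When [dot x y] is not real, a detour is made through a vector [z] orthogonal to [x] whose
    product with [y] is real. *)
Lemma horizontal_transitive (x y : 'cV[K]_n.+1) :
    x ord_max 0 = 0 -> y ord_max 0 = 0 -> dot x x = dot y y ->
  exists k, [/\ P k, k *m e = e & k *m x = y].
Proof.
move=> xm ym xxyy; have [z [zm zx zz zy]] := orth_normalized x y.
have [||k [Pk ke kx]] := horizontal_move xm zm; first by rewrite zz.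
  by rewrite dotC // zx rmorph0.
have [|l [Pl le lz]] := horizontal_move zm ym _ zy; first by rewrite zz.
by exists (l *m k); rewrite -!mulmxA ke kx; split=> //; exact: PM.
Qed.

Lemma horizontal_last (w : 'cV[K]_n.+1) :
  (w - w ord_max 0 *: e) ord_max 0 = 0.
Proof. by rewrite !mxE !eqxx mulr1 subrr. Qed.

Lemma dot_horizontal (w : 'cV[K]_n.+1) :
  dot (w - w ord_max 0 *: e) (w - w ord_max 0 *: e) =
  hdot w w + `|w ord_max 0| ^+ 2.
Proof.
rewrite hdotE // dotBl // !dotBr !dotZr !dotZl // dot_ee !dot_deltal.
rewrite [dot w e]dotC // dot_deltal -mul_cj; ring.
Qed.

(* The Lorentz group acts on hyperbolic space, and [|A ord_max ord_max|] is the
   hyperbolic cosine of the distance from [e] to [A e].  Rotations around [D e]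
   move [e] to any distance at most twice the distance from [e] to [D e]. *)
Lemma rotations_reach A D : unitary_lorentz A -> unitary_lorentz D ->
    `|A ord_max ord_max| <= `|D ord_max ord_max| ->
    1 < `|D ord_max ord_max| ->
  exists k l, [/\ P k, P l, k *m e = e, l *m e = e &
    `|(invmx A *m (l *m (D *m (k *m invmx D)))) ord_max ord_max| = 1].
Proof.
move=> UA UD AD D1; pose a : K := `|A ord_max ord_max|.
have a1 : 1 <= a by exact: unitary_lorentz_ge1.
have [uA _] := unitary_lorentzV UA.
have [uD ED] := unitary_lorentzV UD.
pose q := invmx D *m e; pose s : K := q ord_max 0; pose x := q - s *: e.
have xm : x ord_max 0 = 0 by exact: horizontal_last.
have hqq : hdot q q = -1.
  rewrite /q hdot_unitary //; last exact: unitary_lorentz_inv.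
  by rewrite hdot_el // mxE !eqxx.
have ns : `|s| = `|D ord_max ord_max|.
  have := hdot_unitary q e UD; rewrite /q mulKVmx // hdot_el // -colE mxE.
  rewrite hdotE // dotC // dot_deltal -/q -/s mxE !eqxx mulr1.
  rewrite (_ : _ - _ = - cj s); last by ring.
  by move=> /oppr_inj ->; rewrite norm_cj.
have xx : dot x x = `|s| ^+ 2 - 1 by rewrite dot_horizontal hqq addrC.
have qE : q = x + s *: e by rewrite subrK.
clearbody x.
have xx0 : 0 < dot x x by rewrite xx subr_gt0 expr_gt1 // ns.
have [z [zm zx zz _]] := orth_normalized x x.
have xz : dot x z = 0 by rewrite dotC // zx rmorph0.
(* If [k] fixes [e] and sends [x] to [t *: x + r *: z], then [hdot q (k *m q)] is [t * dot x x]
   minus the squared modulus of [s]; [t] makes this [- a]. The bounds on [a] proved next give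
   [0 <= t <= 1]. *)
pose t := (`|s| ^+ 2 - a) / dot x x.
have sa : a <= `|s| ^+ 2.
  by rewrite (le_trans AD) // -ns ler_eXnr // ns ltW.
have t0 : 0 <= t by rewrite divr_ge0 ?subr_ge0 // ltW.
have t1 : t <= 1 by rewrite ler_pdivrMr // mul1r xx lerB.
(* This [r] gives [x'] the length of [x], so some [k] fixing [e] carries [x] to [x']. *)
have [r r0 rE] : exists2 r : K, 0 <= r & r ^+ 2 = 1 - t ^+ 2.
  by apply: sqrtK; rewrite subr_ge0 exprn_ile1.
pose x' := t *: x + r *: z.
have x'm : x' ord_max 0 = 0.
  by rewrite mxE [X in X + _]mxE [X in _ + X]mxE xm zm !mulr0 addr0.
have [|k [Pk ke kx]] := horizontal_transitive xm x'm.
  rewrite dotDl // !dotDr !dotZr !dotZl // zx xz zz !(cj_ge0 mul_cj) //.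
  rewrite [RHS](_ : _ = (t ^+ 2 + r ^+ 2) * dot x x); last by ring.
  by rewrite rE; ring.
pose w1 := D *m (k *m q).
have kq : k *m q = x' + s *: e.
  by rewrite qE mulmxDr kx -scalemxAr ke.
have hqk : hdot q (k *m q) = - a.
  rewrite kq hdotE // qE dotDl // !dotDr !dotZr !dotZl //.
  rewrite [dot x e]dotC // !dot_deltal xm xz rmorph0.
  rewrite [(x' + _) _ _]mxE [(x + _) _ _]mxE x'm xm [X in 0 + X]mxE.
  rewrite [e _ _]mxE !eqxx.
  rewrite (_ : t * _ = `|s| ^+ 2 - a); last by rewrite /t divfK ?lt0r_neq0.
  rewrite zm -mul_cj !mulr1 !add0r; ring.
have w1e : w1 ord_max 0 = a.
  apply: oppr_inj; rewrite -(hdot_el cjK) -hqk /w1.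
  by rewrite -(hdot_unitary q _ UD) /q mulKVmx.
have hw1 : hdot w1 w1 = -1.
  by rewrite (hdot_unitary _ _ UD) (hdot_unitary _ _ (PU Pk)).

have a0 : a != 0 by rewrite gt_eqF // (lt_le_trans _ a1).
(* The last coordinate of [A *m e] has only modulus [a]; this phase makes it equal to [a], the last
   coordinate of [w1]. *)
pose lam := a / A ord_max ord_max.
have lam1 : `|lam| = 1 by rewrite normf_div normr_id divff.
pose w2 := lam *: (A *m e).
have w2e : w2 ord_max 0 = a by rewrite mxE -colE mxE divfK // -normr_eq0.
have hw2 : hdot w2 w2 = -1.
  rewrite /w2 !scalemxAr hdot_unitary // hdotE // !dotZr !dotZl // dot_ee.
  rewrite !mxE !eqxx !mulr1 (_ : _ - _ = - (lam * cj lam)); last by ring.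
  by rewrite mul_cj lam1 expr1n.
(* Both vectors have form value -1 and last coordinate [a], so their horizontal parts are equally
   long. *)
have [|||l [Pl le lw]] :=
    @horizontal_transitive (w1 - w1 ord_max 0 *: e) (w2 - w2 ord_max 0 *: e).
- exact: horizontal_last.
- exact: horizontal_last.
- by rewrite !dot_horizontal hw1 hw2 w1e w2e.
have {}lw : l *m w1 = w2.
  move: lw; rewrite w1e w2e mulmxBr -scalemxAr le => /eqP.
  by rewrite -subr_eq0 opprB addrA subrK subr_eq0 => /eqP.
exists k, l; split=> //.
have colB (B : 'M[K]_n.+1) : B ord_max ord_max = (B *m e) ord_max 0.
  by rewrite -colE [RHS]mxE.
rewrite colB -!mulmxA -/q -/w1 lw /w2 -scalemxAr mulKmx //.
by rewrite !mxE !eqxx mulr1 lam1.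
Qed.
End transitivity.

(** * Topological groups and spaces of matrices *)

Lemma connected_locally_constant (T : topologicalType) (P : T -> Prop) :
    connected [set: T] ->
    (forall x, \forall y \near x, P y <-> P x) ->
  forall x y, P x -> P y.
Proof.
move=> cT locP x y Px.
suff : P = [set: T] by rewrite predeqE => /(_ y) [_]; exact.
apply: cT; first by exists x.
- exists P; rewrite ?setTI // openE => z Pz.
  by move: (locP z); apply: filterS => t [_]; exact.
- exists P; rewrite ?setTI // => z /(_ _ (locP z)) [t [Pt [+ _]]]; exact.
Qed.

(** If [Phi S] failed, the sets [X] with [Phi (S]\[X)] would form a proper filter containing [S],
    and a cluster point of it in [S] would contradict the local hypothesis. *)
Lemma compact_local_to_global (T : topologicalType) (S : set T)
    (Phi : set T -> Prop) :
    compact S -> Phi set0 ->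
    (forall A B, A `<=` B -> Phi B -> Phi A) ->
    (forall A B, Phi A -> Phi B -> Phi (A `|` B)) ->
    (forall x, S x -> exists2 V, nbhs x V & Phi (S `&` V)) ->
  Phi S.
Proof.
move=> cS Phi0 PhiS PhiU locPhi; apply: contrapT => nPhi.
pose F : set_system T := [set X | Phi (S `\` X)].
have PF : ProperFilter F.
  split; first by rewrite /F /= setD0.
  split; rewrite /F /=; first by rewrite setDT.
    move=> X Y FX FY; apply: PhiS (PhiU _ _ FX FY) => z [Sz nXY].
    by have [Xz|nXz] := pselect (X z); [right; split=> // Yz; apply: nXY|left].
  by move=> X Y XY; apply: PhiS; exact: setDS.
have FS : F S by rewrite /F /= setDv.
have [x [Sx clx]] := cS F PF FS.
have [V Vx PhiV] := locPhi x Sx.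
have FV : F (~` V) by rewrite /F /= setDE setCK.
by have [y []] := clx _ _ FV Vx.
Qed.

Section topological_group.
Variable G : topologicalGroupType.

Lemma mulg_continuousl (x : G) : continuous (fun y => (x * y)%g).
Proof.
move=> y; apply: (@continuous_comp _ _ _ (fun y => (x, y))
  (fun p : G * G => (p.1 * p.2)%g)).
  by apply: cvg_pair => //; exact: cvg_cst.
exact: mulg_continuous.
Qed.

Lemma mulg_continuousr (x : G) : continuous (fun y => (y * x)%g).
Proof.
move=> y; apply: (@continuous_comp _ _ _ (fun y => (y, x))
  (fun p : G * G => (p.1 * p.2)%g)).
  by apply: cvg_pair => //; exact: cvg_cst.
exact: mulg_continuous.
Qed.

Lemma near_conjg (x : G) (P : set G) : nbhs 1%g P ->
  \forall y \near 1%g, P (x * y * x^-1)%g.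
Proof.
move=> P1; have E : (x * 1 * x^-1 = 1)%g by rewrite mulg1 mulgV.
apply: (@continuous_comp _ _ _ (fun y => x * y)%g (fun y => y * x^-1)%g 1%g
  (@mulg_continuousl x _) (@mulg_continuousr _ _)).
by rewrite /= E.
Qed.

(** Membership in [S] is locally constant: for [y] near [x], the quotient of [x] and [y] is near 1,
    hence in [S]. *)
Lemma connected_open_subgroup (S : set G) : connected [set: G] ->
    (forall x y, S x -> S y -> S (x * y)%g) ->
    (forall x, S x -> S (x^-1)%g) -> nbhs 1%g S ->
  forall x, S x.
Proof.
move=> cG SM SV S1 x.
apply: (@connected_locally_constant G S cG _ 1%g x (nbhs_singleton S1)) => {}x.
have nS : \forall y \near x, S (x^-1 * y)%g.
  by apply: (@mulg_continuousl x^-1%g x); rewrite mulVg.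
apply: filterS nS => y Sxy.
split=> Sy; last by rewrite -(mulVKg x y); exact: SM.
have -> : x = (y * (x^-1 * y)^-1)%g by rewrite invgM invgK mulVKg.
by apply: SM => //; exact: SV.
Qed.

End topological_group.

Section matrix_topology.
Variables (K : numFieldType) (m p : nat).

Lemma cvg_mx_entries (T : Type) (F : set_system T) (X : T -> 'M[K]_(m, p))
    (M : 'M[K]_(m, p)) : Filter F ->
  (forall i j, X t i j @[t --> F] --> M i j) -> X t @[t --> F] --> M.
Proof.
move=> FF XM B [P MP PB].
have : \forall t \near F, forall i j, P i j (X t i j).
  apply: filter_forall => i; apply: filter_forall => j.
  exact: XM (MP i j).
by apply: filterS => t Pt; exact: PB.
Qed.

Lemma continuous_mx_entries (T : topologicalType) (X : T -> 'M[K]_(m, p)) :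
  (forall i j, continuous (fun t => X t i j)) -> continuous X.
Proof. by move=> cX t; apply: cvg_mx_entries => i j; exact: cX. Qed.

Lemma closed_entry_ball (B : 'M[K]_(m, p)) (c : K) :
  (forall c : K, compact [set x : K | `|x| <= c]) ->
  closed [set A : 'M[K]_(m, p) | forall i j, `|A i j - B i j| <= c].
Proof.
move=> disc; rewrite (_ : mkset _ = \bigcap_(q in [set: 'I_m * 'I_p])
    ((fun A : 'M[K]_(m, p) => A q.1 q.2 - B q.1 q.2) @^-1`
       [set x | `|x| <= c])).
  apply: closed_bigI => -[i j] _; apply: preimage_closed.
    move=> A _; exact: (cvgB (@coord_continuous K m p i j A) (cvg_cst _)).
  exact: (compact_closed (@norm_hausdorff K K^o) (disc c)).
rewrite predeqE => A; split=> [H [i j] _|H i j]; first exact: H.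
exact: (H (i, j)).
Qed.

(** The matrices with entries bounded by [c] are the image under [vec_mx] of a product of compact
    discs. *)
Lemma mx_bounded_closed_compact (S : set 'M[K]_(m, p)) (c : K) :
  (forall c : K, compact [set x : K | `|x| <= c]) ->
  closed S -> (forall A, S A -> forall i j, `|A i j| <= c) -> compact S.
Proof.
move=> disc cS bS.
have cV := @rV_compact K (m * p) (fun=> [set x : K | `|x| <= c]) (fun=> disc c).
apply: (subclosed_compact cS (B := vec_mx @` [set v : 'rV[K]_(m * p) |
  forall i, `|v ord0 i| <= c])); last first.
  move=> A SA; exists (mxvec A); last by rewrite mxvecK.
  move=> i; case/mxvec_indexP: i => i j; rewrite mxvecE; exact: bS.
apply: continuous_compact cV; apply: continuous_subspaceT.
apply: continuous_mx_entries => i j.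
rewrite (_ : (fun t => _) =
    (fun t : 'rV[K]_(m * p) => t ord0 (mxvec_index i j))).
  exact: coord_continuous.
by apply/funext => t; rewrite mxE.
Qed.

End matrix_topology.

Lemma mulmx_cvg (K : numFieldType) m p q (T : Type) (F : set_system T)
    (X : T -> 'M[K]_(m, p)) (Y : T -> 'M[K]_(p, q))
    (A : 'M[K]_(m, p)) (B : 'M[K]_(p, q)) : Filter F ->
  X t @[t --> F] --> A -> Y t @[t --> F] --> B ->
  (X t *m Y t) @[t --> F] --> A *m B.
Proof.
move=> FF XA YB; apply: cvg_mx_entries => i j.
rewrite mxE (_ : (fun t => _) = fun t => \sum_k X t i k * Y t k j); last first.
  by apply/funext => t; rewrite mxE.
apply: (@cvg_big K 'I_p +%R 0 xpredT (@add_continuous K^o)) => k _; apply: cvgM.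
  exact: (cvg_comp _ _ XA (@coord_continuous _ _ _ _ _ A)).
exact: (cvg_comp _ _ YB (@coord_continuous _ _ _ _ _ B)).
Qed.

Lemma mulmx_continuousl (K : numFieldType) m p q (A : 'M[K]_(m, p)) :
  continuous (fun B : 'M[K]_(p, q) => A *m B).
Proof. by move=> B; exact: (mulmx_cvg _ (cvg_cst A) (@cvg_id _ (nbhs B))). Qed.

(** * Correspondence between a group and a locally isomorphic matrix group *)

Section correspondence.
Variables (G : topologicalGroupType) (K : numFieldType) (m : nat).
Variable L : set 'M[K]_m.
Hypothesis G_connected : connected [set: G].
Hypothesis Z_finite : finite_set (group_center G).
Hypothesis LM : forall A B, L A -> L B -> L (A *m B).
Hypothesis LV : forall A, L A -> L (invmx A).
Hypothesis LU : forall A, L A -> A \in unitmx.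
Hypothesis L_closed : closed L.
Hypothesis disc_compact : forall c : K, compact [set x : K | `|x| <= c].

Variables (U : set G) (W : set 'M[K]_m) (f : G -> 'M[K]_m) (g : 'M[K]_m -> G).
Hypothesis U1 : open_nbhs 1%g U.
Hypothesis W1 : open_nbhs (1%:M : 'M[K]_m) W.
Hypothesis fU : {homo f : x / U x >-> (L `&` W) x}.
Hypothesis gL : {homo g : y / (L `&` W) y >-> U y}.
Hypothesis fK : forall x, U x -> g (f x) = x.
Hypothesis gK : forall y, (L `&` W) y -> f (g y) = y.
Hypothesis g_continuous : {within L `&` W, continuous g}.
Hypothesis fM : forall x y, U x -> U y -> U (x * y)%g ->
  f (x * y)%g = f x *m f y.

(* Through [f], conjugation by [x] near 1 in [G] is conjugation by [A]. *)
Definition corr (x : G) (A : 'M[K]_m) : Prop :=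
  L A /\ \forall y \near 1%g, f (x * y * x^-1)%g *m A = A *m f y.

Lemma corrM x y A B : corr x A -> corr y B -> corr (x * y)%g (A *m B).
Proof.
move=> [LA HA] [LB HB]; split; first exact: LM.
have HA' := near_conjg y HA; near=> z.
have -> : (x * y * z * (x * y)^-1 = x * (y * z * y^-1) * x^-1)%g.
  by rewrite invgM !mulgA.
rewrite mulmxA; have -> : f (x * (y * z * y^-1) * x^-1)%g *m A =
    A *m f (y * z * y^-1)%g.
  by near: z.
by rewrite -mulmxA -[RHS]mulmxA; congr (_ *m _); near: z.
Unshelve. all: by end_near. Qed.

Lemma corrV x A : corr x A -> corr (x^-1)%g (invmx A).
Proof.
move=> [LA HA]; split; first exact: LV.
have uA := LU LA.
apply: filterS (near_conjg (x^-1)%g HA) => y /=; rewrite invgK.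
have -> : (x * (x^-1 * y * x) * x^-1 = y)%g.
  by rewrite -[(x^-1 * y * x)%g]mulgA mulVKg mulgK.
move=> H; apply: (can_inj (mulKmx uA)); rewrite mulmxA -H mulmxK //.
by rewrite mulKVmx.
Qed.

(** For [y] near 1 both sides equal [f (x * y)], by multiplicativity of [f] on [U]. *)
Lemma corr_local x : U x -> corr x (f x).
Proof.
have [oU U1'] := U1.
move=> Ux; split; first by have [] := fU Ux.
have nU : nbhs 1%g U by exact: open_nbhs_nbhs.
have nxU : \forall y \near 1%g, U (x * y)%g.
  apply: (@mulg_continuousl _ x 1%g); rewrite mulg1.
  by apply: open_nbhs_nbhs.
have nxxU : \forall y \near 1%g, U (x * y * x^-1)%g by exact: (near_conjg x nU).
near=> y; rewrite -!fM ?mulgVK //; near: y => //.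
Unshelve. all: by end_near. Qed.

(** The elements having a matrix form a subgroup containing [U], and [G] is connected. *)
Lemma corr_total x : exists A, corr x A.
Proof.
apply: (@connected_open_subgroup _ [set x | exists A, corr x A]) => //.
- by move=> y z [A yA] [B zB]; exists (A *m B); exact: corrM.
- by move=> y [A yA]; exists (invmx A); exact: corrV.
- apply: filterS (open_nbhs_nbhs U1) => y Uy; exists (f y); exact: corr_local.
Qed.

(** As [f] is injective on [U], such an [x] commutes with a neighbourhood of 1; its centraliser is
    then an open subgroup of the connected group [G]. *)
Lemma corr1_central x : corr x 1%:M -> group_center G x.
Proof.
move=> [_ H]; have [oU U1'] := U1.
have nU : nbhs 1%g U by exact: open_nbhs_nbhs.
apply: (@connected_open_subgroup _ [set y | x * y = y * x]%g) => //.
- by move=> y z /= xy xz; rewrite mulgA xy -mulgA xz mulgA.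
- by move=> y /= xy; apply: (mulgI y); rewrite mulgA -xy mulgK mulVKg.
near=> y; apply: (mulIg x^-1)%g; rewrite mulgK.
have Uy : U y by near: y.
have Uxy : U (x * y * x^-1)%g by near: y; exact: (near_conjg x nU).
rewrite -(fK Uxy) -[RHS](fK Uy); congr g.
by rewrite -[LHS]mulmx1 -[RHS]mul1mx; near: y.
Unshelve. all: by end_near. Qed.

Definition corr_image : set 'M[K]_m := [set A | exists x, corr x A].

Lemma corr_image_nbhs : nbhs (1%:M : 'M[K]_m) [set A | L A -> corr_image A].
Proof.
apply: filterS (open_nbhs_nbhs W1) => A WA LA; have LWA : (L `&` W) A by [].
by exists (g A); rewrite -{2}(gK LWA); apply: corr_local; exact: gL.
Qed.

(** An open subgroup of a closed group is closed: a limit [A] has some [B] in the image so close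
    that [invmx A *m B] is in the image too. *)
Lemma corr_image_closed : closed corr_image.
Proof.
move=> A clA; have LA : L A.
  by apply: L_closed => V /clA [B [[x [LB _]] VB]]; exists B.
have : nbhs A [set B | L (invmx A *m B) -> corr_image (invmx A *m B)].
  apply: (@mulmx_continuousl _ _ _ _ (invmx A) A [set C | L C -> corr_image C]).
  rewrite mulVmx ?LU //.
  exact: corr_image_nbhs.
move=> /clA [B [[x xB] /= H]]; have LB := xB.1.
have [|y yAB] := H; first by apply: LM => //; exact: LV.
exists (x * y^-1)%g.
have -> : A = B *m invmx (invmx A *m B).
  have uAB : invmx A *m B \in unitmx by rewrite unitmx_mul unitmx_inv !LU.
  apply: (can_inj (mulmxK uAB)); rewrite mulmxKV //.
  by rewrite mulKVmx // LU.
by apply: corrM => //; exact: corrV.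
Qed.

(** This transfers compactness from matrices to [G]. By compactness of the bounded part of the image
    it suffices to work near the matrix [A] of some [x]. There the elements lie in [x] times a
    compact neighbourhood given by [g] times the center, which is finite. *)
Lemma corr_proper (c : K) : exists2 Q : set G, compact Q &
  forall x A, corr x A -> (forall i j, `|A i j| <= c) -> Q x.
Proof.
pose S := corr_image `&` [set A : 'M[K]_m | forall i j, `|A i j| <= c].
pose Phi (T : set 'M[K]_m) := exists2 Q : set G, compact Q &
  forall x A, corr x A -> T A -> Q x.
suff [Q cQ HQ] : Phi S.
  by exists Q => // x A xA cA; apply: HQ (xA) _; split=> //; exists x.
apply: compact_local_to_global.
- apply: (@mx_bounded_closed_compact _ _ _ _ c) => [//||A [_]//].
  apply: closedI; first exact: corr_image_closed.
  have := @closed_entry_ball K m m 0 c disc_compact.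
  by under eq_set do under eq_forall do under eq_forall do rewrite mxE subr0.
- by exists set0; [exact: compact0|].
- by move=> A B AB [Q cQ HQ]; exists Q => // x M xM /AB; exact: HQ.
- move=> A B [Q cQ HQ] [Q' cQ' HQ']; exists (Q `|` Q'); first exact: compactU.
  by move=> x M xM [/(HQ _ _ xM)|/(HQ' _ _ xM)]; [left|right].
move=> A [[x xA] _]; have LA := xA.1.
have [e e0 eW] : exists2 e : K, 0 < e & ball (1%:M : 'M[K]_m) e `<=` W.
  by apply/nbhs_ballP; exact: open_nbhs_nbhs.
(* Half the radius gives a closed ball inside [W], whose trace on [L] is compact and on which [g] is
   continuous. *)
pose W0 := [set C : 'M[K]_m |
  forall i j, `|C i j - (1%:M : 'M[K]_m) i j| <= e / 2].
have W0W : W0 `<=` W.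
  move=> C W0C; apply: eW; split=> // i j.
  rewrite -(@ball_normE K K^o) /ball_ /= distrC.
  by rewrite (le_lt_trans (W0C i j)) // ltr_pdivrMr // ltr_pMr // ltr1n.
have W0nbhs : nbhs (1%:M : 'M[K]_m) W0.
  apply/nbhs_ballP; exists (e / 2); first by rewrite /= divr_gt0.
  by move=> C [_ H] i j; rewrite distrC ltW //; exact: H.
have cLW0 : compact (L `&` W0).
  apply: (@mx_bounded_closed_compact _ _ _ _ (e / 2 + 1)) => //.
    by apply: closedI => //; exact: closed_entry_ball.
  move=> C [_ W0C] i j.
  rewrite -(subrK ((1%:M : 'M[K]_m) i j) (C i j)) (le_trans (ler_normD _ _)) //.
  rewrite lerD // mxE; case: (i == j); rewrite ?normr1 ?normr0 //.
pose Q0 := g @` (L `&` W0).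
have cQ0 : compact Q0.
  apply: continuous_compact => //; apply: continuous_subspaceW g_continuous.
  by move=> C [LC /W0W].
exists [set B | W0 (invmx A *m B)].
  apply: (@mulmx_continuousl _ _ _ _ (invmx A) A W0).
  by rewrite mulVmx ?LU.
exists ((fun p : G * G => x * p.1 * p.2)%g @` (Q0 `*` group_center G)).
  apply: continuous_compact; last first.
    by apply: compact_setX => //; exact: finite_compact.
  apply: continuous_subspaceT => p.
  apply: (@continuous_comp _ _ _ (fun p : G * G => (x * p.1, p.2)%g)
    (fun p : G * G => p.1 * p.2)%g); last exact: mulg_continuous.
  apply: cvg_pair; last exact: cvg_snd.
  apply: (@continuous_comp _ _ _ fst (fun y : G => x * y)%g).
    exact: cvg_fst.
  exact: mulg_continuousl.
move=> y B yB [_ /= W0AB]; have LB := yB.1.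
have LAB : L (invmx A *m B) by apply: LM => //; exact: LV.
have LWAB : (L `&` W) (invmx A *m B) by split=> //; exact: W0W.
pose u := g (invmx A *m B).
have uAB : corr u (invmx A *m B).
  by rewrite -[X in corr _ X](gK LWAB); apply: corr_local; exact: gL.
(* Both [x * u] and [y] have matrix [B], so their quotient has matrix 1 and is central. *)
exists (u, (x * u)^-1 * y)%g; last by rewrite /= mulVKg.
split; first by exists (invmx A *m B).
apply: corr1_central; rewrite -(mulVmx (LU LB)); apply: corrM => //.
by apply: corrV; rewrite -(mulKVmx (LU LA) B); exact: corrM.
Qed.

End correspondence.

(** * Length functions on groups locally isomorphic to Lorentz groups *)

Section reflection_continuity.
Variables (K : numFieldType) (cj : {rmorphism K -> K}).
Hypothesis cjK : involutive cj.
Hypothesis mul_cj : forall x, x * cj x = `|x| ^+ 2.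

Lemma cj_continuous : continuous cj.
Proof.
move=> x B /nbhs_ballP[e e0 xB]; apply/nbhs_ballP; exists e => // y.
rewrite -(@ball_normE K K^o) => xy; apply: xB.
by rewrite -(@ball_normE K K^o) /ball_ /= -rmorphB norm_cj.
Qed.

Lemma adjmx_cvg m p (T : Type) (F : set_system T) (X : T -> 'M[K]_(m, p))
    (A : 'M[K]_(m, p)) : Filter F ->
  X t @[t --> F] --> A -> adjmx cj (X t) @[t --> F] --> adjmx cj A.
Proof.
move=> FF XA; apply: cvg_mx_entries => i j.
rewrite !mxE (_ : (fun t => _) = (fun t => cj (X t j i))); last first.
  by apply/funext => t; rewrite !mxE.
have XA' : X t j i @[t --> F] --> A j i.
  exact: (cvg_comp _ _ XA (@coord_continuous _ _ _ _ _ A)).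
exact: (cvg_comp _ _ XA' (@cj_continuous (A j i))).
Qed.

Lemma refl_cvg m (T : Type) (F : set_system T) (X : T -> 'cV[K]_m)
    (v : 'cV[K]_m) : Filter F -> v != 0 ->
  X t @[t --> F] --> v -> refl cj (X t) @[t --> F] --> refl cj v.
Proof.
move=> FF v0 Xv; have Xv' := adjmx_cvg FF Xv.
have d0 : dot cj v v != 0 by rewrite dot_eq0.
apply: cvgB; first exact: cvg_cst.
apply: cvgZ; last exact: mulmx_cvg.
apply: cvgM; first exact: cvg_cst.
apply: cvgV => //.
exact: (cvg_comp _ _ (mulmx_cvg _ Xv' Xv) (@coord_continuous _ _ _ _ _ _)).
Qed.

Lemma segment_continuous m (v w : 'cV[K]_m) :
  continuous (fun t : K => w + t *: (v - w)).
Proof.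
apply: continuous_mx_entries => i j t.
rewrite (_ : (fun t => _) = (fun t => w i j + t * (v - w) i j)); last first.
  by apply/funext => s; rewrite mxE [X in _ + X]mxE.
exact: (cvgD (cvg_cst _) (cvgM (@cvg_id _ (nbhs t)) (cvg_cst _))).
Qed.

Lemma segment_neq0 m (v w : 'cV[K]_m) (t : K) :
  v != 0 -> w != 0 -> (forall c, v != c *: w) -> w + t *: (v - w) != 0.
Proof.
move=> v0 w0 vw; apply/eqP => E.
have [t0|t0] := eqVneq t 0.
  by move: E w0; rewrite t0 scale0r addr0 => ->; rewrite eqxx.
have /eqP[] := vw (1 - t^-1); apply: (scalerI t0).
have -> : t *: v = - w + t *: w.
  apply/eqP; rewrite -subr_eq -subr_eq0 opprK -scalerBr addrC; exact/eqP.
by rewrite scalerA mulrBr mulr1 divff // scalerBl scale1r addrC.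
Qed.

End reflection_continuity.

Lemma compact_locally_bounded (F : numDomainType) (T : topologicalType)
    (len : T -> F) (Q : set T) : (forall x, 0 <= len x) ->
    (forall x : T, exists c, \forall y \near x, len y <= c) ->
  compact Q -> exists c, forall x, Q x -> len x <= c.
Proof.
move=> len0 loc cQ.
apply: (compact_local_to_global
  (Phi := fun A => exists c, forall x, A x -> len x <= c) cQ).
- by exists 0.
- by move=> A B AB [c cB]; exists c => x /AB; exact: cB.
(* The order of [F] is only partial, so the sum of the absolute values serves as a common upper
   bound. *)
- have le_norm a x : len x <= a -> len x <= `|a|.
    by move=> xa; rewrite ger0_norm // (le_trans (len0 x)).
  move=> A B [c cA] [d dB]; exists (`|c| + `|d|) => x [/cA|/dB] /le_norm xc.
    by rewrite (le_trans xc) // lerDl.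
  by rewrite (le_trans xc) // lerDr.
- move=> x _; have [c nc] := loc x; exists [set y | len y <= c] => //.
  by exists c => y [].
Qed.

(** * Length functions bounded on a noncompact set *)

Section lorentz_subgroup.
Variables (K : numFieldType) (cj : {rmorphism K -> K}) (n : nat).
Hypothesis cjK : involutive cj.
Hypothesis mul_cj : forall x, x * cj x = `|x| ^+ 2.
Hypothesis sqrtK : forall x : K, 0 <= x -> exists2 y : K, 0 <= y & y ^+ 2 = x.
Hypothesis K_connected : connected [set: K].
Hypothesis disc_compact : forall c : K, compact [set x : K | `|x| <= c].
Hypothesis n2 : (2 <= n)%N.
Variable L : set 'M[K]_n.+1.
Hypothesis LU : forall A, L A -> unitary_lorentz cj A.
Hypothesis L1 : L 1%:M.
Hypothesis LM : forall A B, L A -> L B -> L (A *m B).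
Hypothesis LV : forall A, L A -> L (invmx A).
Hypothesis L_closed : closed L.
Hypothesis L_refl : forall v w : 'cV[K]_n.+1, v != 0 -> w != 0 ->
  v ord_max 0 = 0 -> w ord_max 0 = 0 -> L (refl cj v *m refl cj w).

(* The reflection in [v] only depends on the line of [v], and the lines joining
   two distinct lines form a connected family. *)
Lemma open_subgroup_refl (P : set 'M[K]_n.+1) :
    P 1%:M -> (forall A B, P A -> P B -> P (A *m B)) ->
    (forall A, P A -> P (invmx A)) ->
    nbhs (1%:M : 'M[K]_n.+1) [set A | L A -> P A] ->
  forall v w : 'cV[K]_n.+1, v != 0 -> w != 0 ->
  v ord_max 0 = 0 -> w ord_max 0 = 0 -> P (refl cj v *m refl cj w).
Proof.
move=> P1 PM PV P_nbhs v w v0 w0 vm wm.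
have [[c vcw]|nvw] := pselect (exists c, v = c *: w).
  have c0 : c != 0 by apply: contra_neq v0 => c0; rewrite vcw c0 scale0r.
  by rewrite vcw refl_scale // refl_sqr.
have vw c : v != c *: w by apply/eqP => E; apply: nvw; exists c.
pose x t : 'cV[K]_n.+1 := w + t *: (v - w).
have x0 t : x t != 0 by exact: segment_neq0.
have xm t : x t ord_max 0 = 0 by rewrite !mxE vm wm subr0 mulr0 addr0.
suff : P (refl cj (x 1) *m refl cj w) by rewrite /x scale1r addrC subrK.
apply: (@connected_locally_constant K
    (fun t => P (refl cj (x t) *m refl cj w)) K_connected _ 0);
  last by rewrite /x scale0r addr0 refl_sqr.
move=> t.
(* For [s] near [t] this product is near [refl_sqr]'s value 1, and it lies in [L]. *)
have nP : \forall s \near t, P (refl cj (x s) *m refl cj (x t)).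
  have Rt : refl cj (x s) *m refl cj (x t) @[s --> t] --> (1%:M : 'M[K]_n.+1).
    rewrite -(refl_sqr cj (x t)).
    have xt : x s @[s --> t] --> x t by exact: segment_continuous.
    exact: (mulmx_cvg _ (refl_cvg cjK mul_cj _ (x0 t) xt) (cvg_cst _)).
  have nLP : \forall s \near t, L (refl cj (x s) *m refl cj (x t)) ->
    P (refl cj (x s) *m refl cj (x t)) := Rt _ P_nbhs.
  apply: filterS nLP => s; apply.
  exact: L_refl.
have E s : refl cj (x s) *m refl cj w =
    (refl cj (x s) *m refl cj (x t)) *m (refl cj (x t) *m refl cj w).
  by rewrite -mulmxA [refl cj (x t) *m (_ *m _)]mulmxA refl_sqr mul1mx.
apply: filterS nP => s Pst; split=> [|Pt]; last by rewrite E; exact: PM.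
have u : refl cj (x s) *m refl cj (x t) \in unitmx.
  by rewrite unitmx_mul !unitmxE !det_refl // unitrN1.
rewrite E => Ps; rewrite -(mulKmx u (refl cj (x t) *m _)).
by apply: PM => //; exact: PV.
Qed.

Lemma length_bounded (G : topologicalGroupType) (F : numDomainType)
    (len : G -> F) (Lam : set G) (M : F) :
    hausdorff_space G -> connected [set: G] -> finite_set (group_center G) ->
    locally_isomorphic G L ->
    (forall x, 0 <= len x) ->
    (forall x y, len (x * y)%g <= len x + len y) ->
    (forall x, len x^-1%g = len x) ->
    (forall x : G, exists c, \forall y \near x, len y <= c) ->
    ~ compact (closure Lam) -> (forall x, Lam x -> len x <= M) ->
  exists c, forall x, len x <= c.
Proof.
move=> hG cG fZ [U [W [f [g [U1 W1 [fU gL fK gK] [_ cg] fM]]]]].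
move=> len0 lenM lenV len_loc ncLam LamM.
have LUm A : L A -> A \in unitmx by move=> /LU /unitary_lorentzV[].
have fM' x y : U x -> U y -> U (x * y)%g -> f (x * y)%g = f x *m f y.
  by move=> Ux Uy; exact: (fM x y Ux Uy).2.
pose P := corr_image L f.
have P_nbhs := corr_image_nbhs U1 W1 fU gL gK fM'.
have P1 : P 1%:M by exact: nbhs_singleton P_nbhs L1.
have PM A B : P A -> P B -> P (A *m B).
  by move=> [x xA] [y yB]; exists (x * y)%g; exact: corrM.
have PV A : P A -> P (invmx A).
  by move=> [x xA]; exists x^-1%g; exact: corrV.
have P_refl := open_subgroup_refl P1 PM PV P_nbhs.
have PU A : P A -> unitary_lorentz cj A by move=> [x [/LU]].
have proper := corr_proper cG fZ LM LV LUm L_closed disc_compact U1 W1 fU gL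
  fK gK cg fM'.
have [Q cQ HQ] := proper 1.
have [c cQb] := compact_locally_bounded len0 len_loc cQ.
(* Such matrices have all entries of modulus at most 1, so the corresponding elements lie in the
   compact set [Q]. They include those fixing the base point. *)
have small x A : corr L f x A -> `|A ord_max ord_max| = 1 -> len x <= c.
  move=> xA A1; apply: cQb; apply: HQ (xA) _ => i j; rewrite -A1.
  by apply: le_unitary_lorentz => //; exact: LU xA.1.
(* The bound follows the factorisation of [x] below: [v], [u] and the last factor have length at
   most [c], and the two occurrences of [y] at most [M]. *)
exists (c + (M + (c + M)) + c) => x.
have [A xA] := corr_total cG LM LV LUm U1 fU fM' x.
(* Otherwise all of [Lam] would have bounded matrices and lie in a compact set, closed as [G] is
   Hausdorff. The summand 1 ensures that [D] moves the base point. *)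
have [y [D [Ly yD AD]]] : exists y D, [/\ Lam y, corr L f y D &
    `|A ord_max ord_max| + 1 < `|D ord_max ord_max|].
  apply: contrapT => nD; apply: ncLam.
  have [Q' cQ' HQ'] := proper (`|A ord_max ord_max| + 1).
  apply: (subclosed_compact (@closed_closure _ _) cQ').
  rewrite (closure_id Q').1; last exact: compact_closed.
  apply: closureS => y Ly.
  have [D yD] := corr_total cG LM LV LUm U1 fU fM' y.
  apply: HQ' (yD) _ => i j.
  apply: le_trans (le_unitary_lorentz _ _ _ _ _) _ => //.
    exact: LU yD.1.
  rewrite real_leNgt ?realD ?normr_real //; apply/negP => lt.
  by apply: nD; exists y, D.
have UA := LU xA.1; have UD := LU yD.1.
have [|| k [l [Pk Pl ke le kl]]] :=
  rotations_reach cjK mul_cj sqrtK n2 P1 PM PU P_refl UA UD.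
- by rewrite ltW // (le_lt_trans _ AD) // lerDl.
- by rewrite (le_lt_trans _ AD) // lerDr.
have fixE (B : 'M[K]_n.+1) :
    B *m delta_mx ord_max 0 = delta_mx ord_max 0 :> 'cV[K]_n.+1 ->
    `|B ord_max ord_max| = 1.
  by move=> /matrixP/(_ ord_max 0); rewrite -colE !mxE !eqxx => ->;
    rewrite normr1.
have [u uk] := Pk; have [v vl] := Pl.
have w := small (x^-1 * (v * (y * (u * y^-1))))%g _ _ kl.
have {}w : len (x^-1 * (v * (y * (u * y^-1))))%g <= c.
  by apply: w; do ?[apply: corrM => //]; exact: corrV.
have -> : x = ((v * (y * (u * y^-1))) * (x^-1 * (v * (y * (u * y^-1))))^-1)%g.
  by rewrite invgM invgK mulVKg.
rewrite (le_trans (lenM _ _)) // lenV lerD //.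
rewrite (le_trans (lenM _ _)) // lerD //.
  by apply: small vl _; exact: fixE.
rewrite (le_trans (lenM _ _)) // lerD //; first exact: LamM.
rewrite (le_trans (lenM _ _)) // lerD //.
  by apply: small uk _; exact: fixE.
by rewrite lenV LamM.
Qed.

End lorentz_subgroup.

Local Open Scope complex_scope.

(** * Bounded cocycles *)

Lemma ge0_ReK (R : realType) (z : R[i]) : 0 <= z -> (complex.Re z)%:C = z.
Proof. by case: z => a b /ger0_Im /= ->. Qed.

Section circumcenter.
Variables (R : realType) (H : hilbertType R).

(** The norm of [H] takes values in [R[i]]; a real-valued square allows infima and linear
    arithmetic. *)
Definition nsq (x : H) : R := complex.Re (`|x| ^+ 2).

Lemma nsqE x : (nsq x)%:C = `|x| ^+ 2.
Proof. by rewrite /nsq ge0_ReK // exprn_ge0. Qed.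

Lemma nsq_ge0 x : 0 <= nsq x.
Proof. by rewrite -lecR nsqE exprn_ge0. Qed.

Lemma parallelogram (x y : H) :
  nsq (x + y) + nsq (x - y) = 2 * nsq x + 2 * nsq y.
Proof.
apply: (@complexI R).
rewrite !rmorphD !rmorphM /= !nsqE rmorph_nat -!inner_norm.
rewrite !linearDl !linearDr !linearNl !linearNr /=; ring.
Qed.

(** The median formula: the parallelogram law for the halves of [s - x] and [s - y]. *)
Lemma nsq_midpoint (s x y : H) :
  nsq (s - 2^-1 *: (x + y)) = (nsq (s - x) + nsq (s - y)) / 2 - nsq (x - y) / 4.
Proof.
have half (z : H) : nsq (2^-1 *: z) = nsq z / 4.
  apply: (@complexI R).
  rewrite rmorphM /= fmorphV rmorph_nat !nsqE normrZ exprMn.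
  rewrite ger0_norm ?invr_ge0 // mulrC exprVn; congr (_ / _); ring.
have := parallelogram (2^-1 *: (s - x)) (2^-1 *: (s - y)).
have -> : 2^-1 *: (s - x) + 2^-1 *: (s - y) = s - 2^-1 *: (x + y).
  rewrite -scalerDr addrACA -opprD scalerBr -[s + s]mulr2n.
  by rewrite -[s *+ 2](scaler_nat 2 s) scalerA mulVf ?scale1r // pnatr_eq0.
have -> : 2^-1 *: (s - x) - 2^-1 *: (s - y) = - (2^-1 *: (x - y)).
  by rewrite -scalerBr opprB addrC addrA subrK -opprB scalerN.
have -> : nsq (- (2^-1 *: (x - y))) = nsq (2^-1 *: (x - y)).
  by rewrite /nsq normrN.
rewrite !half => E; lra.
Qed.

(** [E r] consists of the centres of balls of squared radius [r] containing the family, and [q] is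
    the infimum of these [r]. By the median formula the sets [E (q + e)] shrink to a point [c] as
    [e] tends to 0, and [T] maps each of them into itself. *)
Lemma circumcenter (I : Type) (s : I -> H) (M : R) (i0 : I) :
    (forall i, nsq (s i) <= M) ->
  exists c : H, forall T : H -> H, (forall x y, `|T x - T y| = `|x - y|) ->
    (forall i, exists j, forall x, `|s i - T x| = `|s j - x|) -> T c = c.
Proof.
move=> sM; pose E (r : R) := [set x : H | forall i, nsq (s i - x) <= r].
pose A := [set r : R | E r !=set0].
have A0 : has_inf A.
  split; first by exists M, 0 => i; rewrite subr0.
  by exists 0 => r [x /(_ i0)]; apply: le_trans; exact: nsq_ge0.
pose q := inf A.
have Edist e x y : E (q + e) x -> E (q + e) y -> nsq (x - y) <= 4 * e.
  move=> Ex Ey; suff : q <= q + e - nsq (x - y) / 4 by lra.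
  apply: ge_inf; first exact: A0.2.
  (* The midpoint is a better centre, yet no squared radius is below [q]. *)
  exists (2^-1 *: (x + y)) => i; rewrite nsq_midpoint.
  by have := Ex i; have := Ey i; lra.
have Emono e e' : e <= e' -> E (q + e) `<=` E (q + e').
  by move=> ee x Ex i; rewrite (le_trans (Ex i)) // lerD2l.
pose F := filter_from [set e : R | 0 < e] (fun e => E (q + e)).
have PF : ProperFilter F.
  apply: filter_from_proper; last first.
    move=> e e0; have [r [x Ex] rq] := inf_adherent e0 A0.
    by exists x => i; rewrite (le_trans (Ex i)) // ltW.
  apply: filter_from_filter; first by exists 1 => /=.
  move=> e e' e0 e'0; exists (Num.min e e') => /=; first by rewrite lt_min e0.
  by move=> x Ex; split; apply: Emono Ex; rewrite ge_min lexx ?orbT.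
have /cvg_ex[c Fc] : cvg F.
  apply: cauchy_cvg; apply/cauchy_ballP => e e0.
  have [r r0 ->] : exists2 r : R, 0 < r & e = r%:C.
    by exists (complex.Re e); rewrite ?ge0_ReK -?ltcR ?ge0_ReK // ltW.
  (* By [Edist] this set has squared diameter at most [r ^+ 2 / 2], which is less than [r ^+ 2]. *)
  have E1 : F (E (q + r ^+ 2 / 8)) by exists (r ^+ 2 / 8) => //=; nra.
  exists (E (q + r ^+ 2 / 8), E (q + r ^+ 2 / 8)) => // -[x y] [/= Ex Ey].
  rewrite -ball_normE /ball_ /=.
  rewrite -(@ltr_pXn2r _ 2) ?nnegrE ?ler0c ?normr_ge0 ?(ltW r0) //.
  rewrite -nsqE -rmorphXn ltcR (le_lt_trans (Edist _ _ _ Ex Ey)) //; nra.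
exists c => T isoT symT; apply/eqP; rewrite -subr_eq0 -normr_le0.
apply/ler_addgt0Pr => e e0; rewrite add0r.
have [r r0 ->] : exists2 r : R, 0 < r & e = r%:C.
  by exists (complex.Re e); rewrite ?ge0_ReK -?ltcR ?ge0_ReK // ltW.
have r30 : 0 < r / 3 by lra.
(* Points of this set are at distance at most [r / 3]; [T c - c] is later split into three terms of
   this size through [T x] and [x]. *)
have E1 : F (E (q + (r / 3) ^+ 2 / 4)) by exists ((r / 3) ^+ 2 / 4) => //=; nra.
have E2 : F (ball c (r / 3)%:C).
  by apply: Fc; apply: nbhsx_ballx; rewrite ltcR.
have [x [Ex]] := filter_ex (filterI E1 E2).
rewrite -ball_normE /ball_ /= => cx.
have ETx : E (q + (r / 3) ^+ 2 / 4) (T x).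
  by move=> i; have [j ij] := symT i; rewrite /nsq ij; exact: Ex.
have xTx : `|T x - x| <= (r / 3)%:C.
  rewrite -(@ler_pXn2r _ 2) ?nnegrE ?ler0c ?normr_ge0 ?(ltW r30) //.
  rewrite -nsqE -rmorphXn lecR.
  by rewrite (le_trans (Edist _ _ _ ETx Ex)) //; lra.
have -> : T c - c = (T c - T x) + (T x - x) - (c - x).
  by rewrite addrA subrK opprB addrA subrK.
rewrite (le_trans (ler_normB _ _)) //.
rewrite (_ : r = r / 3 + r / 3 + r / 3); last by lra.
rewrite !rmorphD /= lerD //; last exact: ltW.
by rewrite (le_trans (ler_normD _ _)) // lerD // isoT ltW.
Qed.

End circumcenter.

Section bounded_cocycle.
Variables (R : realType) (G : topologicalGroupType) (H : hilbertType R).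
Variable pi : unitaryRep G H.

Lemma rep_funB g u v : pi g (u - v) = pi g u - pi g v.
Proof. by rewrite -scaleN1r addrC rep_linear scaleN1r addrC. Qed.

Lemma norm_rep g v : `|pi g v| = `|v|.
Proof.
by apply/eqP; rewrite -(@eqrXn2 _ 2) // -!inner_norm rep_unitary.
Qed.

Variable b : G -> H.
Hypothesis bM : forall g h, b (g * h)%g = b g + pi g (b h).

Lemma cocycle1 : b 1%g = 0.
Proof.
have /eqP := bM 1 1; rewrite mulg1 rep1 -subr_eq0 opprD addrA subrr sub0r.
by rewrite oppr_eq0 => /eqP.
Qed.

Lemma norm_cocycleV g : `|b g^-1%g| = `|b g|.
Proof.
have := bM g g^-1; rewrite mulgV cocycle1 => /esym/eqP; rewrite addrC addr_eq0.
by move=> /eqP E; rewrite -(norm_rep g) E normrN.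
Qed.

Lemma norm_cocycleM g h : `|b (g * h)%g| <= `|b g| + `|b h|.
Proof. by rewrite bM -(norm_rep g (b h)) ler_normD. Qed.

(** The affine isometries sending [x] to [pi g x + b g] permute the range of [b], the orbit of 0, so
    they fix its circumcenter. *)
Lemma bounded_cocycle_coboundary (c : R[i]) :
  (forall g, `|b g| <= c) -> exists v, forall g, b g = pi g v - v.
Proof.
move=> bc.
have [|v vP] := @circumcenter R H G b (complex.Re (c ^+ 2)) 1%g.
  move=> g; rewrite -lecR nsqE ge0_ReK.
    by rewrite lerXn2r ?nnegrE // (le_trans _ (bc g)).
  by rewrite exprn_ge0 // (le_trans _ (bc g)).
(* The fixed point satisfies [b g = v - pi g v], whence the sign. *)
exists (- v) => g.
have Tv : pi g v + b g = v.
  apply: (vP (fun x => pi g x + b g)).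
    by move=> x y; rewrite opprD addrACA subrr addr0 -rep_funB norm_rep.
  move=> h; exists (g^-1 * h)%g => x.
  have -> : b h = b g + pi g (b (g^-1 * h)%g) by rewrite -bM mulVKg.
  by rewrite [pi g x + _]addrC opprD addrACA subrr add0r -rep_funB norm_rep.
have -> : pi g (- v) = - pi g v by rewrite -[- v]sub0r rep_funB rep_fun0 sub0r.
by rewrite -[X in _ - - X]Tv opprK addrA addNr add0r.
Qed.

End bounded_cocycle.

(** * The groups SO(n,1) and SU(n,1) *)

Section special_unitary_lorentz.
Variables (K : numFieldType) (cj : {rmorphism K -> K}) (n : nat).
Hypothesis cjK : involutive cj.
Hypothesis mul_cj : forall x, x * cj x = `|x| ^+ 2.

(** With conjugation as [cj] this is [SU_n1]; with the identity of [R], its component of 1 is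
    [SO_n1]. *)
Definition SUlorentz : set 'M[K]_n.+1 :=
  [set A | \det A = 1 /\ unitary_lorentz cj A].

Lemma hdot_normE (x : 'cV[K]_n.+1) : hdot cj x x =
  \sum_(i < n) `|x (lift ord_max i) 0| ^+ 2 - `|x ord_max 0| ^+ 2.
Proof.
rewrite hdotE // dot_norm // (bigD1_ord ord_max) //= -mulrA [cj _ * _]mulrC.
by rewrite mul_cj; ring.
Qed.

(** Polarisation: once the diagonal vanishes, the form at [delta_mx i 0 + cj (B i j) *: delta_mx j
    0] is twice the squared modulus of [B i j]. *)
Lemma hermitian_form0 m (B : 'M[K]_m) : adjmx cj B = B ->
  (forall x : 'cV[K]_m, dot cj x (B *m x) = 0) -> B = 0.
Proof.
move=> adjB B0; apply/matrixP => i j; rewrite mxE.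
have Bij k l : dot cj (delta_mx k 0) (B *m delta_mx l 0) = B k l.
  by rewrite dot_deltal -colE mxE.
have Bii k : B k k = 0 by rewrite -Bij B0.
have Bji : B j i = cj (B i j) by rewrite -{1}adjB !mxE.
have := B0 (delta_mx i 0 + cj (B i j) *: delta_mx j 0).
rewrite mulmxDr -scalemxAr dotDl // !dotDr !dotZl // !dotZr !Bij !Bii Bji cjK.
rewrite !mulr0 addr0 add0r [cj _ * _]mulrC mul_cj -mulr2n => /eqP.
rewrite mulrn_eq0 /=.
by rewrite expf_eq0 /= normr_eq0 => /eqP.
Qed.

Lemma unitary_lorentzP (A : 'M[K]_n.+1) :
  (forall x, hdot cj (A *m x) (A *m x) = hdot cj x x) <-> unitary_lorentz cj A.
Proof.
split=> [HA|UA x]; last exact: hdot_unitary.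
apply/eqP; rewrite -subr_eq0; apply/eqP; apply: hermitian_form0.
  by rewrite adjmxB !adjmxM (adjmxK cjK) (lorentz_mx_adj _ cjK mul_cj) mulmxA.
move=> x; rewrite mulmxBl dotBr -!mulmxA -dot_mulmx.
by apply/eqP; rewrite subr_eq0; apply/eqP; exact: HA.
Qed.

Lemma SUlorentz1 : SUlorentz 1%:M.
Proof. by split; rewrite ?det1 // /unitary_lorentz adjmx1 mul1mx mulmx1. Qed.

Lemma SUlorentzM A B : SUlorentz A -> SUlorentz B -> SUlorentz (A *m B).
Proof.
move=> [dA UA] [dB UB]; split; first by rewrite det_mulmx dA dB mulr1.
exact: unitary_lorentz_mul.
Qed.

Lemma SUlorentzV A : SUlorentz A -> SUlorentz (invmx A).
Proof.
move=> [dA UA]; split; first by rewrite det_inv dA invr1.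
exact: unitary_lorentz_inv.
Qed.

Lemma SUlorentz_refl (v w : 'cV[K]_n.+1) : v != 0 -> w != 0 ->
  v ord_max 0 = 0 -> w ord_max 0 = 0 -> SUlorentz (refl cj v *m refl cj w).
Proof.
move=> v0 w0 vm wm; split; first by rewrite det_mulmx !det_refl // mulrNN mulr1.
by apply: unitary_lorentz_mul; exact: unitary_lorentz_refl.
Qed.

Lemma det_continuous m : continuous (determinant : 'M[K]_m -> K).
Proof.
apply: (@continuous_big K _ +%R 0 xpredT (@add_continuous K^o)) => /= s _ A.
have prodA : \prod_i B i ((s : {perm 'I_m}) i) @[B --> A] -->
    \prod_i A i ((s : {perm 'I_m}) i).
  apply: (@continuous_big K _ *%R 1 xpredT (@mul_continuous K)) => i _.
  exact: coord_continuous.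
exact: (cvgM (cvg_cst _) prodA).
Qed.

Lemma SUlorentz_closed : closed SUlorentz.
Proof.
have c1 (T : topologicalType) (y : T) : hausdorff_space T -> closed [set y].
  by move=> hT; apply: compact_closed => //; exact: compact_set1.
have -> : SUlorentz = determinant @^-1` [set 1] `&`
    (fun A => adjmx cj A *m lorentz_mx cj n *m A) @^-1` [set lorentz_mx cj n].
  by [].
apply: closedI; apply: preimage_closed.
- by move=> A _; exact: det_continuous.
- by apply: c1; exact: (@norm_hausdorff K K^o).
- move=> A _; have Ac : B @[B --> A] --> A by exact: cvg_id.
  exact: (mulmx_cvg _ (mulmx_cvg _ (adjmx_cvg cjK mul_cj _ Ac) (cvg_cst _)) Ac).
- by apply: c1; exact: norm_hausdorff.
Qed.

Definition SUlorentz0 : set 'M[K]_n.+1 := connected_component SUlorentz 1%:M.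

Lemma SUlorentz_translate A (B : set 'M[K]_n.+1) :
  SUlorentz A -> connected B -> B `<=` SUlorentz ->
  connected (mulmx A @` B) /\ mulmx A @` B `<=` SUlorentz.
Proof.
move=> SA cB BS; split.
  apply: connected_continuous_connected => //; apply: continuous_subspaceT.
  exact: mulmx_continuousl.
by move=> _ [C BC <-]; apply: SUlorentzM => //; exact: BS.
Qed.

Lemma SUlorentz0_sub : SUlorentz0 `<=` SUlorentz.
Proof. exact: connected_component_sub. Qed.

Lemma SUlorentz01 : SUlorentz0 1%:M.
Proof. by apply: connected_component_refl; exact: SUlorentz1. Qed.

(** The translate of the component by [A] is connected and contains [A], so it lies in the component
    of [A], which is that of 1. *)
Lemma SUlorentz0M A B : SUlorentz0 A -> SUlorentz0 B -> SUlorentz0 (A *m B).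
Proof.
move=> A0 B0; have [c s] := SUlorentz_translate (SUlorentz0_sub A0)
  (@component_connected _ _ _) SUlorentz0_sub.
apply: connected_component_trans A0 _.
apply: (connected_component_max _ s c); last by exists B.
by exists 1%:M; [exact: SUlorentz01|rewrite mulmx1].
Qed.

Lemma SUlorentz0V A : SUlorentz0 A -> SUlorentz0 (invmx A).
Proof.
move=> A0; have SA := SUlorentz0_sub A0.
have [c s] := SUlorentz_translate (SUlorentzV SA)
  (@component_connected _ _ _) SUlorentz0_sub.
have uA : A \in unitmx by have [] := unitary_lorentzV SA.2.
apply: (connected_component_max _ s c).
  by exists A => //; rewrite mulVmx.
by exists 1%:M; [exact: SUlorentz01|rewrite mulmx1].
Qed.

Lemma SUlorentz0_closed : closed SUlorentz0.
Proof. by apply: component_closed; exact: SUlorentz_closed. Qed.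

(** Moving the first vector along the line through [w] and [v] joins 1 to the product inside
    [SUlorentz]. *)
Lemma SUlorentz0_refl (v w : 'cV[K]_n.+1) : connected [set: K] ->
  v != 0 -> w != 0 ->
  v ord_max 0 = 0 -> w ord_max 0 = 0 -> SUlorentz0 (refl cj v *m refl cj w).
Proof.
move=> cK v0 w0 vm wm.
have [[c vcw]|nvw] := pselect (exists c, v = c *: w).
  have c0 : c != 0 by apply: contra_neq v0 => c0; rewrite vcw c0 scale0r.
  by rewrite vcw refl_scale // refl_sqr; exact: SUlorentz01.
have vw c : v != c *: w by apply/eqP => E; apply: nvw; exists c.
pose x t : 'cV[K]_n.+1 := w + t *: (v - w).
have x0 t : x t != 0 by exact: segment_neq0.
have xm t : x t ord_max 0 = 0 by rewrite !mxE vm wm subr0 mulr0 addr0.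
pose X := (fun t => refl cj (x t) *m refl cj w) @` [set: K].
apply: (@connected_component_max _ _ X).
- by exists 0 => //; rewrite /x scale0r addr0 refl_sqr.
- by move=> _ [t _ <-]; exact: SUlorentz_refl.
- apply: connected_continuous_connected => //; apply: continuous_subspaceT => t.
  have xt : x s @[s --> t] --> x t by exact: segment_continuous.
  exact: (mulmx_cvg _ (refl_cvg cjK mul_cj _ (x0 t) xt) (cvg_cst _)).
- by exists 1 => //; rewrite /x scale1r addrC subrK.
Qed.

End special_unitary_lorentz.

(** * The real case *)

Section real_field.
Variable R : realType.

Lemma mul_idfun (x : R) : x * idfun x = `|x| ^+ 2.
Proof. by rewrite real_normK ?num_real. Qed.

Lemma real_sqrt_exists (x : R) : 0 <= x -> exists2 y : R, 0 <= y & y ^+ 2 = x.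
Proof. by move=> x0; exists (Num.sqrt x); rewrite ?sqr_sqrtr ?sqrtr_ge0. Qed.

Lemma real_connected : connected [set: R].
Proof. by apply/connected_intervalP. Qed.

Lemma real_disc_compact (c : R) : compact [set x : R | `|x| <= c].
Proof.
rewrite (_ : mkset _ = `[- c, c]%classic); first exact: segment_compact.
by apply/seteqP; split=> x /=; rewrite in_itv /= ler_norml.
Qed.

Lemma SO_n1E n : SO_n1 R n = @SUlorentz0 R (idfun : {rmorphism R -> R}) n.
Proof.
rewrite /SO_n1 /SUlorentz0; congr connected_component.
have E x : lorentz_form x = hdot (idfun : {rmorphism R -> R}) x x :> R.
  rewrite (hdot_normE _ mul_idfun) // /lorentz_form real_normK ?num_real //.
  by congr (_ - _); apply: eq_bigr => i _; rewrite real_normK ?num_real.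
apply/seteqP; split=> A [dA HA]; split=> //.
  by apply/(unitary_lorentzP _ mul_idfun) => // x; rewrite -!E.
by move=> x; rewrite !E hdot_unitary.
Qed.

End real_field.

(** * The complex case *)

Section complex_field.
Variable R : realType.
Local Notation cj := (@conjc R : {rmorphism R[i] -> R[i]}).
Local Notation C := (R[i] : numFieldType).

Lemma mul_conjc (x : R[i]) : x * cj x = `|x| ^+ 2.
Proof. by rewrite sqr_normc. Qed.

Lemma complex_sqrt_exists (x : R[i]) :
  0 <= x -> exists2 y : R[i], 0 <= y & y ^+ 2 = x.
Proof. by move=> x0; exists (sqrtC x); rewrite ?sqrtC_ge0 ?sqrtCK. Qed.

Lemma norm_real_complex (t : R) : `|t%:C| = `|t|%:C.
Proof. by rewrite normc_def /= expr0n addr0 sqrtr_sqr. Qed.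

Lemma real_complex_continuous : continuous (fun t : R => t%:C : C).
Proof.
move=> t B /nbhs_ballP[e e0 tB]; apply/nbhs_ballP.
have [r r0 re] : exists2 r : R, 0 < r & e = r%:C.
  by exists (complex.Re e); rewrite ?ge0_ReK -?ltcR ?ge0_ReK // ltW.
exists r => // s; rewrite -(@ball_normE R R^o) /ball_ /= => ts; apply: tB.
rewrite -(@ball_normE C C^o) /ball_ /= re -rmorphB norm_real_complex ltcR.
exact: ts.
Qed.

Lemma complex_connected : connected [set: C].
Proof.
have -> : [set: C] =
    \bigcup_(z in [set: C]) ((fun t : R => t%:C * z : C) @` [set: R]).
  apply/seteqP; split=> // z _; exists z => //.
  by exists 1 => //; rewrite mul1r.
apply: bigcup_connected.
  by exists 0 => z _; exists 0 => //; rewrite mul0r.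
move=> z _; apply: connected_continuous_connected; first exact: real_connected.
apply: continuous_subspaceT => t.
exact: (cvgM (@real_complex_continuous t) (cvg_cst _)).
Qed.

Lemma complex_disc_compact (c : C) : compact [set x : C | `|x| <= c].
Proof.
have cl : closed [set x : C | `|x| <= c].
  move=> x clx; apply/ler_addgt0Pr => e e0.
  have [y [yc]] := clx _ (nbhsx_ballx x e e0).
  rewrite -(@ball_normE C C^o) /ball_ /= => xy.
  rewrite -(subrK y x) (le_trans (ler_normD _ _)) // addrC lerD //.
  exact: ltW.
(* Any member of the disc forces [c] to be a nonnegative real, hence equal to its real part. *)
pose r := complex.Re c.
pose f (p : R * R) : C := p.1%:C + 'i * p.2%:C.
apply: (subclosed_compact cl (B := f @` (`[- r, r] `*` `[- r, r]))).
  apply: continuous_compact; last first.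
    by apply: compact_setX; exact: segment_compact.
  apply: continuous_subspaceT => p.
  have c1 : (q.1%:C : C) @[q --> p] --> (p.1%:C : C).
    apply: (@continuous_comp _ _ _ fst (fun t : R => t%:C : C)).
      exact: cvg_fst.
    exact: real_complex_continuous.
  have c2 : (q.2%:C : C) @[q --> p] --> (p.2%:C : C).
    apply: (@continuous_comp _ _ _ snd (fun t : R => t%:C : C)).
      exact: cvg_snd.
    exact: real_complex_continuous.
  exact: (cvgD c1 (cvgM (cvg_cst _) c2)).
move=> z zc; exists (complex.Re z, complex.Im z); last first.
  by rewrite /f /= -complexE.
have c0 : 0 <= c by rewrite (le_trans _ zc).
have : (complex.Re z) ^+ 2 + (complex.Im z) ^+ 2 <= r ^+ 2.
  rewrite -lecR [leRHS]rmorphXn /= ge0_ReK //.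
  rewrite (le_trans _ (lerXn2r 2 _ _ zc)) //.
  by rewrite normc_def -rmorphXn sqr_sqrtr // addr_ge0 ?sqr_ge0.
have r0 : 0 <= r by rewrite -ler0c ge0_ReK.
by move=> H; split; rewrite /= in_itv /=; apply/andP; split; nra.
Qed.

Lemma SU_n1E n : SU_n1 R n = @SUlorentz _ cj n.
Proof.
have E x : lorentz_hermitian_form x = hdot cj x x :> R[i].
  by rewrite (hdot_normE _ mul_conjc) //; exact: conjcK.
apply/seteqP; split=> A [dA HA]; split=> //.
  apply/(unitary_lorentzP _ mul_conjc); first exact: conjcK.
  by move=> x; rewrite -!E.
by move=> x; rewrite !E hdot_unitary.
Qed.

End complex_field.

(** * Bounded lengths in both cases and injectivity of restriction *)

Lemma length_bounded_rank1 (R : realType) (G : topologicalGroupType) :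
  connected_simple_lie_group R G ->
  finite_set (group_center G) ->
  (exists n : nat, (3 <= n)%N /\ locally_isomorphic G (SO_n1 R n)) \/
  (exists n : nat, (2 <= n)%N /\ locally_isomorphic G (SU_n1 R n)) ->
  forall (F : numDomainType) (len : G -> F) (Lam : set G) (M : F),
    (forall x, 0 <= len x) ->
    (forall x y, len (x * y)%g <= len x + len y) ->
    (forall x, len x^-1%g = len x) ->
    (forall x : G, exists c, \forall y \near x, len y <= c) ->
    ~ compact (closure Lam) -> (forall x, Lam x -> len x <= M) ->
  exists c, forall x, len x <= c.
Proof.
move=> [[hG _ _] cG _ _] fZ [[n [n3]]|[n [n2]]].
  rewrite SO_n1E => iso F len Lam M.
  pose cj : {rmorphism R -> R} := idfun; have cjK : involutive cj by [].
  have mulcj : forall x, x * cj x = `|x| ^+ 2 := @mul_idfun R.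
  exact: (length_bounded cjK mulcj (@real_sqrt_exists R) (@real_connected R)
    (@real_disc_compact R) (ltnW n3) (fun A LA => (SUlorentz0_sub LA).2)
    (@SUlorentz01 _ cj n) (@SUlorentz0M _ cj n) (SUlorentz0V cjK mulcj)
    (SUlorentz0_closed cjK mulcj)
    (fun v w => SUlorentz0_refl cjK mulcj (@real_connected R))).
rewrite SU_n1E => iso F len Lam M.
pose cj : {rmorphism R[i] -> R[i]} := @conjc R.
have cjK : involutive cj by exact: conjcK.
have mulcj : forall x, x * cj x = `|x| ^+ 2 := @mul_conjc R.
exact: (length_bounded cjK mulcj (@complex_sqrt_exists R) (@complex_connected R)
  (@complex_disc_compact R) n2 (fun A (LA : SUlorentz cj A) => LA.2)
  (@SUlorentz1 _ cj n) (@SUlorentzM _ cj n) (SUlorentzV cjK mulcj)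
  (SUlorentz_closed cjK mulcj) (@SUlorentz_refl _ cj n cjK mulcj)).
Qed.

Theorem theorem1p12 (R : realType) (G : topologicalGroupType) :
  connected_simple_lie_group R G ->
  finite_set (group_center G) ->
  (exists n : nat, (3 <= n)%N /\ locally_isomorphic G (SO_n1 R n)) \/
  (exists n : nat, (2 <= n)%N /\ locally_isomorphic G (SU_n1 R n)) ->
  forall (H : hilbertType R) (pi : unitaryRep G H) (Lambda : subgroup G),
    ~ compact (closure (subgroup_set Lambda)) ->
    injective (H1_res pi Lambda).
Proof.
move=> simpleG fZ iso H pi Lam ncLam x y.
rewrite -(H1_classK x) -(H1_classK y) !H1_resE => /eqP; rewrite H1_class_eq.
set b := repr x; set b' := repr y => Bbb; apply/eqP; rewrite H1_class_eq.
have : val (b - b') \in cocycle pi := valP (b - b').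
rewrite inE => -[cb bM].
have : (fun g => val (b - b') (val g)) \in coboundary (res_rep pi Lam).
  exact: Bbb.
rewrite unfold_in !inE => -[v Hv].
pose len g := `|val (b - b') g|.
(* On [Lam] the cocycle [b - b'] is [pi g v - v], of norm at most twice that of [v]. *)
have [|||||c bc] := length_bounded_rank1 simpleG fZ iso (len := len)
  (M := `|v| + `|v|) _ _ _ _ ncLam.
- by move=> g; rewrite normr_ge0.
- by move=> g h; exact: norm_cocycleM.
- by move=> g; exact: norm_cocycleV.
- move=> g; exists (`|val (b - b') g| + 1).
  have nb : \forall h \near g, ball (val (b - b') g) 1 (val (b - b') h).
    by apply: cb; apply: nbhsx_ballx.
  apply: filterS nb => h; rewrite -ball_normE /ball_ /= distrC => /ltW hg.
  by rewrite addrC -lerBlDr (le_trans (lerB_dist _ _)).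
- move=> g Lg.
  have E : val (b - b') g = pi g v - v := Hv (exist _ g (mem_set Lg)).
  by rewrite /len E (le_trans (ler_normB _ _)) // norm_rep.
exact: (bounded_cocycle_coboundary bM (c := c)).
Qed.
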